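(* Let $x\in\{7,9,10\}$, let $v$ be a positive integer with $x+1\leq\lfloor v/2\rfloor$ and let $L$ be a multiset of size $v-1$ with support $\{1,x,x+1\}$, where $v$ is coprime to each element of the support (that is, $\gcd(v,x)=\gcd(v,x+1)=1$). Then $L$ has a realization. In particular, for each prime $v$ with $x+1\leq\lfloor v/2\rfloor$, every multiset of size $v-1$ with support $\{1,x,x+1\}$ has a realization (Buratti's Conjecture holds for multisets with these supports).
   Context: The support of a multiset $L$ is the set of distinct elements of $L$. Let $K_v$ be the complete graph on vertex set $\{0,1,\ldots,v-1\}$. The (cyclic) length of the edge between distinct vertices $u,w$ is $\ell(u,w)=\min(|u-w|,\,v-|u-w|)$. A realization of a multiset $L$ of size $v-1$ is a Hamiltonian path in $K_v$ whose multiset of cyclic edge lengths is $L$. Buratti's Conjecture asserts that for prime $v$ every multiset of size $v-1$ with support contained in $\{1,\ldots,\lfloor v/2\rfloor\}$ has a realization. *)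

(* Defs.v *)
From mathcomp Require Import all_boot ssralg ssrint.
From mathcomp Require Export finmap multiset.

Set Implicit Arguments.
Unset Strict Implicit.
Unset Printing Implicit Defensive.

Definition complete_graph (v : nat) : rel 'I_v := fun u w => u != w.

(* A path is given by the list of its vertices in order of traversal. *)
Definition hamiltonian_path (T : finType) (e : rel T) (p : seq T) : Prop :=
  [/\ sorted e p, uniq p & forall u : T, u \in p].

(* The difference inside `|u - w|%N is taken in int, so this is the absolute
   difference. The outer subtraction is truncated, but `|u - w| < v. *)
Definition cyclic_length (v : nat) (u w : 'I_v) : nat :=
  minn `|u - w|%N (v - `|u - w|%N).

Definition edge_lengths (v : nat) (p : seq 'I_v) : seq nat :=
  if p is u :: q then pairmap (@cyclic_length v) u q else [::].

Definition realization (v : nat) (L : {mset nat}%mset) (p : seq 'I_v) : Prop :=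
  hamiltonian_path (@complete_graph v) p /\ seq_mset (edge_lengths p) = L.

Definition has_realization (v : nat) (L : {mset nat}%mset) : Prop :=
  exists p : seq 'I_v, realization L p.

(* Main.v *)
Require Import Defs.
From mathcomp Require Import all_boot.
From Stdlib Require Import Ascii String.
From mathcomp Require Import ssrint zify.

(** A Hamiltonian path of the circulant graph on Z_v that uses only the lengths
    1, x and x + 1 is determined, up to translation, by its steps, and the
    multiset of its lengths by three multiplicities (a, b, c).  Fix x.  The
    proof produces a path for each of the infinitely many admissible triples
    from finitely many explicit ones, by growing them.

    Growth.  Read each edge of length l as an arc going up from its lower end u
    to u + l modulo v.  Cut the cyclic order between m and m + 1; an arc from u
    crosses the cut when its offset m - u (modulo v) is less than its length.
    Suppose the offsets of the crossing arcs are 0, 1, ..., d - 1, once each.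
    After a translation the cut lies between v - 1 and 0, so the crossing arcs
    start at the d largest vertices.  Append d new vertices v, ..., v + d - 1,
    and replace the crossing arc from u to w by the arc from u to u + d followed
    by the arc from u + d to w.  In Z_(v + d) the second arc is as long as the old
    one was, so the multiset of lengths gains exactly d copies of d, and the
    result is again a Hamiltonian path (growth).  Moreover the offsets at every
    cut, the present one included, are what they were before (edge_stretch shows
    this for a single edge).  Hence growth can be repeated, and growths at
    different cuts for d = 1, x and x + 1 are independent of each other: a path
    growable for all three lengths yields every triple
    (a + i, b + j x, c + k (x + 1)).

    Finiteness.  Each path of a finite list thus accounts for a product of
    three sets, each of them a singleton or an arithmetic progression whose
    difference is 1, x or x + 1.  Whether such products cover all triples
    with v coprime to x and x + 1 depends only on the entries of the triple up
    to a bound and, beyond it, on their residues (required_representative,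
    covers_representative), so that the cover can be checked by evaluation
    (covered_realizable).  The lists for x = 7, 9 and 10, of 510, 1027 and 1450
    paths, were found by local search, moving from path to path by reversing
    segments until the multiplicities and the growability were as wanted. *)

Set Implicit Arguments.
Unset Strict Implicit.
Unset Printing Implicit Defensive.

(** * Arcs and cuts of the cyclic order *)

Definition clockwise v u w := if u <= w then w - u else v + w - u.

(** The lower end and the length of the shorter of the two arcs that join [u]
    and [w]; an edge of length less than v / 2 has only one such arc. *)
Definition short_arc v u w :=
  if clockwise v u w < clockwise v w u then (u, clockwise v u w)
  else (w, clockwise v w u).

Definition arcs v (p : seq nat) :=
  if p is u :: q then pairmap (short_arc v) u q else [::].

Definition lengths v p := [seq e.2 | e <- arcs v p].

(** How far below the cut between [m] and [m + 1] the arcs that cross it start. *)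
Definition offsets v m (s : seq (nat * nat)) :=
  [seq clockwise v e.1 m | e <- s & clockwise v e.1 m < e.2].

(** Hamiltonian paths of K_v, with natural numbers as vertices: the number [v]
    of vertices changes during growth. *)
Definition hamiltonian v p := perm_eq p (iota 0 v).

Definition growable v p d :=
  exists2 m, m < v & perm_eq (offsets v m (arcs v p)) (iota 0 d).

(* Splits the innermost comparison first, so that no hypothesis contains an
   [if] and [lia] understands all of them. *)
Ltac if_free t :=
  lazymatch t with context [if _ then _ else _] => fail | _ => idtac end.
Ltac split_comparisons := repeat (match goal with
  | |- context [if ?a <= ?b then _ else _] =>
      if_free a; if_free b; case: (leqP a b) => ?
  end; rewrite /=).

Lemma hamiltonianP v p :
  reflect [/\ size p = v, uniq p & all (gtn v) p] (hamiltonian v p).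
Proof.
apply: (iffP idP) => [h|[sz up al]].
  rewrite (perm_size h) size_iota (perm_uniq h) iota_uniq (perm_all _ h); split=> //.
  by apply/allP=> u; rewrite mem_iota.
have sub: {subset p <= iota 0 v} by move=> u /(allP al); rewrite mem_iota.
apply: uniq_perm => //; first exact: iota_uniq.
by have [] := uniq_min_size up sub; rewrite ?size_iota ?sz.
Qed.

Lemma arcs_bound v p : all (gtn v) p -> all (fun e => e.1 < v) (arcs v p).
Proof.
case: p => //= u p; elim: p u => //= w p IH u /and3P [hu hw al].
by rewrite IH ?hw // andbT /short_arc; case: ifP.
Qed.

Lemma offsets_cat v m s t : offsets v m (s ++ t) = offsets v m s ++ offsets v m t.
Proof. by rewrite /offsets filter_cat map_cat. Qed.

Lemma size_lengths v p : size (lengths v p) = (size p).-1.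
Proof. by rewrite /lengths /arcs size_map; case: p => //= u q; rewrite size_pairmap. Qed.

(** * Translations *)

Definition translate v k u := if u + k < v then u + k else u + k - v.

Lemma translate_lt v k u : k <= v -> u < v -> translate v k u < v.
Proof. by rewrite /translate; split_comparisons; lia. Qed.

Lemma translate_inj v k : k <= v -> {in gtn v &, injective (translate v k)}.
Proof.
by move=> kv u w; rewrite !inE /= /translate => uv wv; split_comparisons; lia.
Qed.

Lemma clockwise_translate v k u w : k <= v -> u < v -> w < v ->
  clockwise v (translate v k u) (translate v k w) = clockwise v u w.
Proof.
by rewrite /translate => *; split_comparisons; rewrite /clockwise; split_comparisons; lia.
Qed.

Lemma hamiltonian_translate v k p : k <= v -> hamiltonian v p ->
  hamiltonian v (map (translate v k) p).
Proof.
move=> kv /hamiltonianP [sz up al]; apply/hamiltonianP; rewrite size_map; split=> //.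
  rewrite map_inj_in_uniq // => u w /(allP al) hu /(allP al) hw; exact: translate_inj.
by rewrite all_map; apply: sub_all al => u /=; apply: translate_lt.
Qed.

Lemma arcs_translate v k p : k <= v -> all (gtn v) p ->
  arcs v (map (translate v k) p) = [seq (translate v k e.1, e.2) | e <- arcs v p].
Proof.
move=> kv; case: p => //= u p; elim: p u => //= w p IH u /and3P [hu hw al].
rewrite IH /= ?hw //; congr cons.
by rewrite /short_arc !clockwise_translate //; case: ifP.
Qed.

Lemma lengths_translate v k p : k <= v -> all (gtn v) p ->
  lengths v (map (translate v k) p) = lengths v p.
Proof. by move=> *; rewrite /lengths arcs_translate // -map_comp. Qed.

Lemma offsets_translate v k m p : k <= v -> m < v -> all (gtn v) p ->
  offsets v (translate v k m) (arcs v (map (translate v k) p)) = offsets v m (arcs v p).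
Proof.
move=> kv mv al; rewrite arcs_translate //.
have := arcs_bound al; elim: (arcs v p) => //= e s IH /andP [he hs].
rewrite /offsets /= clockwise_translate //; case: ifP => _ /=.
  by rewrite -/(offsets _ _ _) IH // clockwise_translate.
by rewrite -/(offsets _ _ _) IH.
Qed.

Lemma growable_translate v k p d : k <= v -> all (gtn v) p ->
  growable v p d -> growable v (map (translate v k) p) d.
Proof.
move=> kv al [m mv h]; exists (translate v k m); first exact: translate_lt.
by rewrite offsets_translate.
Qed.

(** * Growth *)

(** The vertices to put between consecutive vertices [u] and [w]: one, at
    distance [d] above the lower end of their arc, if that arc crosses the cut
    between v - 1 and 0, and none otherwise.  Written with offsets, so that the
    set of all new vertices can be read off from the offsets at that cut. *)
Definition inserted v d u w :=
  [seq v.-1 - t + d | t <- offsets v v.-1 [:: short_arc v u w]].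

Definition stretch v d p :=
  if p is u :: q then
    u :: flatten (pairmap (fun u w => rcons (inserted v d u w) w) u q)
  else [::].

Definition climbs v u w l := (w == u + l) || (w + v == u + l).

Lemma short_arc_climb v u w l : l.*2 < v -> 0 < l -> u < v -> w < v -> climbs v u w l ->
  (short_arc v u w = (u, l)) * (short_arc v w u = (u, l)).
Proof.
rewrite /climbs /short_arc /clockwise => lv l0 uv wv h.
by split; case: (leqP u w) => h1; case: (leqP w u) => h2;
  split_comparisons; try lia; try congr (_, _); lia.
Qed.

Lemma climb_short_arc v k u w : k.*2 < v -> u < v -> w < v -> u != w ->
  (short_arc v u w).2 <= k -> exists2 l, 0 < l <= k & climbs v u w l \/ climbs v w u l.
Proof.
rewrite /climbs /short_arc /clockwise => kv uv wv uw.
by case: (leqP u w) => h1; case: (leqP w u) => h2; split_comparisons => /= h; try lia;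
  [exists (w - u) | exists (v + u - w) | exists (v + w - u) | exists (u - w)]; lia.
Qed.

(** The effect of growth on one edge.  The offsets at another cut [m] survive
    because the two arcs that replace a crossing one start [d] apart, just as
    the numbering above the insertion moves by [d]: exactly one of the two
    crosses [m] if the old arc did, and with the old offset.  This needs the
    old offset at the cut of insertion to be less than [d]. *)
Lemma edge_stretch v k d u w
    (new := pairmap (short_arc (v + d)) u (rcons (inserted v d u w) w)) :
  k.*2 < v -> 0 < d <= k -> u < v -> w < v -> u != w -> (short_arc v u w).2 <= k ->
  all (gtn d) (offsets v v.-1 [:: short_arc v u w]) ->
  [/\ perm_eq [seq e.2 | e <- new]
              ((short_arc v u w).2 :: nseq (size (inserted v d u w)) d),
      forall m, m < v.-1 ->
        offsets (v + d) m new = offsets v m [:: short_arc v u w] &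
      offsets (v + d) (v + d).-1 new = offsets v v.-1 [:: short_arc v u w]].
Proof.
move=> kv /andP [d0 dk] uv wv uw le; rewrite {}/new /inserted.
move: (climb_short_arc kv uv wv uw le) => [l /andP [l0 lk] [c|c]].
  have lv : l.*2 < v by lia.
  have [-> _] := short_arc_climb lv l0 uv wv c; move=> od.
  (* Without wrapping around, the arc does not cross the cut. *)
  have [c'|c'] := orP c.
    have -> /= : offsets v v.-1 [:: (u, l)] = [::].
      by rewrite /offsets /= /clockwise; split_comparisons => //; lia.
    have -> /= : short_arc (v + d) u w = (u, l).
      by have [||||| -> _] := @short_arc_climb (v + d) u w l; rewrite ?/climbs //; lia.
    rewrite /offsets /= /clockwise; split=> // [m mv|]; by split_comparisons => //; lia.
  have e : offsets v v.-1 [:: (u, l)] = [:: v.-1 - u].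
    by rewrite /offsets /= /clockwise; split_comparisons => //; lia.
  move: od; rewrite e /= andbT => od.
  have -> /= : v.-1 - (v.-1 - u) + d = u + d by lia.
  have -> /= : short_arc (v + d) u (u + d) = (u, d).
    by have [||||| -> _] := @short_arc_climb (v + d) u (u + d) d; rewrite ?/climbs //; lia.
  have -> /= : short_arc (v + d) (u + d) w = (u + d, l).
    by have [||||| -> _] := @short_arc_climb (v + d) (u + d) w l; rewrite ?/climbs //; lia.
  split.
  - by rewrite (perm_catC [:: _] [:: _]).
  - by move=> m mv; rewrite /offsets /= /clockwise; split_comparisons => //=; try congr [:: _]; lia.
  - by rewrite /offsets /= /clockwise; split_comparisons => //=; try congr [:: _]; lia.
(* The same when the path descends along the arc, from its upper end u to w. *)
have lv : l.*2 < v by lia.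
have [_ ->] := short_arc_climb lv l0 wv uv c; move=> od.
have [c'|c'] := orP c.
  have -> /= : offsets v v.-1 [:: (w, l)] = [::].
    by rewrite /offsets /= /clockwise; split_comparisons => //; lia.
  have -> /= : short_arc (v + d) u w = (w, l).
    by have [||||| _ ->] := @short_arc_climb (v + d) w u l; rewrite ?/climbs //; lia.
  rewrite /offsets /= /clockwise; split=> // [m mv|]; by split_comparisons => //; lia.
have e : offsets v v.-1 [:: (w, l)] = [:: v.-1 - w].
  by rewrite /offsets /= /clockwise; split_comparisons => //; lia.
move: od; rewrite e /= andbT => od.
have -> /= : v.-1 - (v.-1 - w) + d = w + d by lia.
have -> /= : short_arc (v + d) (w + d) w = (w, d).
  by have [||||| _ ->] := @short_arc_climb (v + d) w (w + d) d; rewrite ?/climbs //; lia.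
have -> /= : short_arc (v + d) u (w + d) = (w + d, l).
  by have [||||| _ ->] := @short_arc_climb (v + d) (w + d) u l; rewrite ?/climbs //; lia.
split.
- by [].
- by move=> m mv; rewrite /offsets /= /clockwise; split_comparisons => //=; try congr [:: _]; lia.
- by rewrite /offsets /= /clockwise; split_comparisons => //=; try congr [:: _]; lia.
Qed.

Lemma arcs_stretch v d u q : arcs (v + d) (stretch v d (u :: q)) =
  flatten (pairmap (fun u w =>
    pairmap (short_arc (v + d)) u (rcons (inserted v d u w) w)) u q).
Proof.
rewrite /arcs /=; elim: q u => //= w q IH u.
by rewrite pairmap_cat last_rcons IH.
Qed.

Lemma inserted_offsets v d u q :
  flatten (pairmap (inserted v d) u q) =
  [seq v.-1 - t + d | t <- offsets v v.-1 (arcs v (u :: q))].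
Proof.
rewrite /arcs; elim: q u => //= w q IH u.
by rewrite IH -cat1s offsets_cat map_cat.
Qed.

Lemma perm_stretch v d u q : perm_eq (stretch v d (u :: q))
  (u :: q ++ [seq v.-1 - t + d | t <- offsets v v.-1 (arcs v (u :: q))]).
Proof.
rewrite -inserted_offsets /= perm_cons; elim: q u => //= w q IH u.
rewrite -cats1 -catA cat1s perm_catC /= perm_cons.
by rewrite perm_catC perm_sym perm_catCA perm_sym perm_cat2l.
Qed.

Definition short_edge v k u w := [&& u < v, w < v, u != w & (short_arc v u w).2 <= k].

Lemma stretch_edges v k d u q (p := u :: q) :
  k.*2 < v -> 0 < d <= k -> path (short_edge v k) u q ->
  all (gtn d) (offsets v v.-1 (arcs v p)) ->
  [/\ perm_eq (lengths (v + d) (stretch v d p))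
              (lengths v p ++ nseq (size (offsets v v.-1 (arcs v p))) d),
      forall m, m < v.-1 ->
        offsets (v + d) m (arcs (v + d) (stretch v d p)) = offsets v m (arcs v p) &
      offsets (v + d) (v + d).-1 (arcs (v + d) (stretch v d p))
        = offsets v v.-1 (arcs v p)].
Proof.
move=> kv dk; rewrite {}/p /lengths arcs_stretch /arcs /=; elim: q u => //= w q IH u.
case/andP=> /and4P [uv wv uw le] pq; rewrite -cat1s offsets_cat all_cat => /andP [od oq].
have [L O T] := edge_stretch kv dk uv wv uw le od.
have [L' O' T'] := IH w pq oq.
split=> [|m mv|].
- rewrite map_cat; apply: perm_trans (perm_cat L L') _.
  by rewrite /= size_cat nseqD perm_cons size_map perm_catCA.
- by rewrite offsets_cat O // O' // -offsets_cat.
- by rewrite offsets_cat T T'.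
Qed.

Lemma perm_reflect_iota v d : d <= v ->
  perm_eq [seq v.-1 - t + d | t <- iota 0 d] (iota v d).
Proof.
move=> dv; apply: uniq_perm; rewrite ?iota_uniq //.
  rewrite map_inj_in_uniq ?iota_uniq // => s t; rewrite !mem_iota; lia.
move=> y; rewrite mem_iota; apply/mapP/idP => [[t]|h].
  rewrite mem_iota; lia.
exists (v.-1 + d - y); rewrite ?mem_iota; lia.
Qed.

Lemma path_short_edge v k u q : hamiltonian v (u :: q) ->
  all (leq^~ k) (lengths v (u :: q)) -> path (short_edge v k) u q.
Proof.
move=> /hamiltonianP [_ up al]; move: up al; rewrite /lengths /=.
elim: q u => //= w q IH u.
rewrite inE negb_or -andbA => /and4P [uw unq wq uq] /and3P [uv wv alq] /andP [le h].
rewrite /short_edge uv wv uw le /=.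
by apply: IH; rewrite /= ?wq ?wv ?unq.
Qed.

(** Growth at one cut adds [d] edges of length [d] and keeps every
    growability, so that it can be iterated and combined with growth for other
    lengths.  The cut is first translated to the place between v - 1 and 0,
    where inserting vertices renumbers nothing. *)
Lemma growth v k d p : k.*2 < v -> 0 < d <= k -> hamiltonian v p ->
  all (leq^~ k) (lengths v p) -> growable v p d ->
  exists p', [/\ hamiltonian (v + d) p',
                 perm_eq (lengths (v + d) p') (lengths v p ++ nseq d d)
               & forall d', growable v p d' -> growable (v + d) p' d'].
Proof.
move=> kv dk hp lp [m mv gm].
have [_ _ al] := hamiltonianP _ _ hp.
set j := v.-1 - m; have jv : j <= v by lia.
pose r := map (translate v j) p.
have hr : hamiltonian v r by exact: hamiltonian_translate.
have lr : lengths v r = lengths v p by exact: lengths_translate.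
have gr : perm_eq (offsets v v.-1 (arcs v r)) (iota 0 d).
  have <- : translate v j m = v.-1 by rewrite /translate; split_comparisons; lia.
  by rewrite offsets_translate.
have gp d' : growable v p d' -> growable v r d' by exact: growable_translate.
move: (hr) lr gr gp.
case: {hr}r => [|u q]; first by move/perm_size; rewrite size_iota /=; lia.
move=> hq lq gq gp.
have oq : all (gtn d) (offsets v v.-1 (arcs v (u :: q))).
  by rewrite (perm_all _ gq); apply/allP=> t; rewrite mem_iota.
have pq : path (short_edge v k) u q by apply: path_short_edge; rewrite ?lq.
have [L O T] := stretch_edges kv dk pq oq.
exists (stretch v d (u :: q)); split.
- rewrite /hamiltonian (perm_trans (perm_stretch v d u q)) // -cat_cons iotaD.
  apply: perm_cat => //; apply: perm_trans (perm_map _ gq) _.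
  by apply: perm_reflect_iota; lia.
- by rewrite (perm_trans L) // lq (perm_size gq) size_iota.
- move=> d' /gp [n nv gn]; have [nv'|nv'] := ltnP n v.-1.
    exists n; rewrite ?O //; lia.
  exists (v + d).-1; first by lia.
  by rewrite T (_ : v.-1 = n) //; lia.
Qed.

Lemma iter_growth v k d n p : k.*2 < v -> 0 < d <= k -> hamiltonian v p ->
  all (leq^~ k) (lengths v p) -> growable v p d ->
  exists p', [/\ hamiltonian (v + n * d) p',
                 perm_eq (lengths (v + n * d) p') (lengths v p ++ nseq (n * d) d)
               & forall d', growable v p d' -> growable (v + n * d) p' d'].
Proof.
move=> kv dk hp lp gp; elim: n => [|n [r [hr lr gr]]].
  by exists p; rewrite !mul0n !addn0 cats0.
have kv' : k.*2 < v + n * d by lia.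
have lr' : all (leq^~ k) (lengths (v + n * d) r).
  rewrite (perm_all _ lr) all_cat lp all_nseq; lia.
have [s [hs ls gs]] := growth kv' dk hr lr' (gr _ gp).
exists s; rewrite mulSn (addnC d) addnA; split=> //.
  by rewrite (perm_trans ls) // nseqD catA perm_cat2r.
by move=> d' h; apply/gs/gr.
Qed.

Definition reachable (g : bool) (d m n : nat) := (n == m) || [&& g, m <= n & d %| n - m].

Lemma grow_multiplicity v k d p (g : bool) m n : k.*2 < v -> 0 < d <= k ->
  hamiltonian v p -> all (leq^~ k) (lengths v p) -> (g -> growable v p d) ->
  reachable g d m n ->
  m <= n /\
  exists p', [/\ hamiltonian (v + (n - m)) p',
                 perm_eq (lengths (v + (n - m)) p') (lengths v p ++ nseq (n - m) d)
               & forall d', growable v p d' -> growable (v + (n - m)) p' d'].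
Proof.
move=> kv dk hp lp gp /orP [/eqP ->|/and3P [/gp gd mn dv]]; split=> //.
  by exists p; rewrite subnn addn0 cats0; split.
by rewrite -(divnK dv); exact: (iter_growth _ kv dk hp lp gd).
Qed.

(** * From paths on natural numbers to realizations *)

Lemma cyclic_length_short_arc v (u w : 'I_v) : u != w ->
  cyclic_length u w = (short_arc v u w).2.
Proof.
case: u w => [u uv] [w wv]; rewrite -val_eqE /cyclic_length /short_arc /= => uw.
have [h|h] := leqP u w.
  by rewrite IntDist.distnEr // /clockwise /minn; split_comparisons; lia.
by rewrite (IntDist.distnEl (ltnW h)) /clockwise /minn; split_comparisons; lia.
Qed.

Lemma edge_lengths_val v (p : seq 'I_v) : uniq p ->
  edge_lengths p = lengths v (map val p).
Proof.
case: p => //= u p; rewrite /lengths /=; elim: p u => //= w p IH u.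
rewrite inE negb_or -andbA => /and4P [uw _ wp up].
by rewrite IH /= ?wp // cyclic_length_short_arc.
Qed.

Lemma hamiltonian_realization v p (L : {mset nat}%mset) : hamiltonian v p ->
  perm_eq (lengths v p) L -> has_realization v L.
Proof.
move=> hp hL; have [sz up al] := hamiltonianP _ _ hp.
have [q qp] : exists q : seq 'I_v, map val q = p.
  exists (pmap insub p); rewrite (pmap_filter (insubK _)).
  by apply/all_filterP; apply: sub_all al => u uv; rewrite insubT.
have uq : uniq q by rewrite -(map_inj_uniq val_inj) qp.
exists q; split; last first.
  by rewrite edge_lengths_val // qp -[RHS]seq_mset_id; apply/eq_seq_msetP.
split=> //.
- case: (q) uq => //= u s; elim: s u => //= w s IH u.
  rewrite inE negb_or -andbA => /and4P [uw _ ws us].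
  by rewrite /complete_graph uw IH //= ws.
- by move=> u; rewrite -(mem_map val_inj) qp (perm_mem hp) mem_iota /=.
Qed.

(** * Finite covers of the set of triples of multiplicities *)

(** The multiplicities of the lengths 1, x, x + 1 in a path, and whether it is
    growable for each of them. *)
Definition profile := (nat * nat * nat * (bool * bool * bool))%type.

(* The size is compared first because it rules out most cuts cheaply. *)
Definition growableb v s d :=
  has (fun m => let o := offsets v m s in
                if size o == d then perm_eq o (iota 0 d) else false) (iota 0 v).

Lemma growablebP v p d : growableb v (arcs v p) d -> growable v p d.
Proof. by case/hasP=> m; rewrite mem_iota => /= mv; case: ifP => // _ h; exists m. Qed.

(** The bound on the number of vertices makes all lengths less than half of it,
    as growth requires. *)
Definition profile_of x p : option profile :=
  let v := size p in let s := arcs v p in let l := [seq e.2 | e <- s] in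
  if [&& x.+1.*2 < v, uniq p, all (gtn v) p & all (mem [:: 1; x; x.+1]) l]
  then Some (count_mem 1 l, count_mem x l, count_mem x.+1 l,
             (growableb v s 1, growableb v s x, growableb v s x.+1))
  else None.

Definition covers x (t : nat * nat * nat) (q : profile) :=
  let: (a, b, c) := t in let: (a0, b0, c0, (ga, gb, gc)) := q in
  [&& reachable ga 1 a0 a, reachable gb x b0 b & reachable gc x.+1 c0 c].

Definition realizable v (l : seq nat) :=
  exists2 p, hamiltonian v p & perm_eq (lengths v p) l.

Lemma perm_nseq3 (y1 y2 y3 : nat) s :
  uniq [:: y1; y2; y3] -> all (mem [:: y1; y2; y3]) s ->
  perm_eq s (nseq (count_mem y1 s) y1 ++ nseq (count_mem y2 s) y2 ++
             nseq (count_mem y3 s) y3).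
Proof.
rewrite /= !inE negb_or andbT => /andP [/andP [n12 n13] n23] /allP sub.
apply/allP => y; rewrite !mem_cat !mem_nseq => hy.
have: y \in [:: y1; y2; y3].
  by case/or4P: hy => [/sub//|||] /andP [_ /eqP ->]; rewrite !inE eqxx ?orbT.
rewrite !inE !count_cat !count_nseq /= => /or3P [] /eqP ->; rewrite !eqxx.
- rewrite [y2 == _]eq_sym [y3 == _]eq_sym (negbTE n12) (negbTE n13).
  by rewrite mul1n !mul0n !addn0.
- by rewrite [y3 == _]eq_sym (negbTE n12) (negbTE n23) mul1n !mul0n !addn0.
- by rewrite (negbTE n13) (negbTE n23) mul1n !mul0n.
Qed.

(** The three multiplicities are adjusted one after the other, which is
    possible because growth for one length keeps the growability for the
    others. *)
Lemma covers_realizable x p q a b c : 1 < x ->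
  profile_of x p = Some q -> covers x (a, b, c) q ->
  realizable (a + b + c).+1 (nseq a 1 ++ nseq b x ++ nseq c x.+1).
Proof.
rewrite /profile_of => x1; case: ifP => // /and4P [].
set v := size p => xv up al sl [<-] /and3P [].
change [seq e.2 | e <- arcs v p] with (lengths v p) in sl |- *.
have := perm_nseq3 _ sl.
set a0 := count_mem 1 _; set b0 := count_mem x _; set c0 := count_mem x.+1 _.
move=> pl ga gb gc.
have {}pl : perm_eq (lengths v p) (nseq a0 1 ++ nseq b0 x ++ nseq c0 x.+1).
  by apply: pl; rewrite /= !inE; clear -x1; lia.
have hp : hamiltonian v p by apply/hamiltonianP.
have lp : all (leq^~ x.+1) (lengths v p).
  by apply: sub_all sl => l; rewrite !inE => /or3P [] /eqP ->; clear -x1; lia.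
have sz : v = (a0 + b0 + c0).+1.
  have := perm_size pl; rewrite !size_cat !size_nseq size_lengths -/v addnA => <-.
  by rewrite prednK //; apply: leq_ltn_trans xv.
have [ha [p1 [h1 l1 g1]]] :=
  @grow_multiplicity v x.+1 1 p _ a0 a xv isT hp lp (@growablebP _ _ _) ga.
have v1 := ltn_addr (a - a0) xv; have x2 : 0 < x <= x.+1 by rewrite (ltnW x1) leqnSn.
have lp1 : all (leq^~ x.+1) (lengths (v + (a - a0)) p1).
  by rewrite (perm_all _ l1) all_cat lp all_nseq orbT.
have [/growablebP /g1 //|hb [p2 [h2 l2 g2]]] :=
  @grow_multiplicity _ x.+1 x p1 _ b0 b v1 x2 h1 lp1 _ gb.
have v2 := ltn_addr (b - b0) v1.
have lp2 : all (leq^~ x.+1) (lengths (v + (a - a0) + (b - b0)) p2).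
  by rewrite (perm_all _ l2) all_cat lp1 all_nseq leqnSn orbT.
have [/growablebP /g1 /g2 //|hc [p3 [h3 l3 g3]]] :=
  @grow_multiplicity _ x.+1 x.+1 p2 _ c0 c v2 (leqnn _) h2 lp2 _ gc.
have e : v + (a - a0) + (b - b0) + (c - c0) = (a + b + c).+1.
  by rewrite sz; clearbody a0 b0 c0; clear -ha hb hc; lia.
rewrite -e; exists p3 => //; apply: perm_trans l3 _; apply/permP => P.
rewrite count_cat (permP l2) count_cat (permP l1) count_cat (permP pl).
rewrite !count_cat !count_nseq.
by clearbody a0 b0 c0; clear -ha hb hc; case: (P 1); case: (P x); case: (P x.+1); lia.
Qed.

(** Beyond the bound [N] only residues modulo [d] matter: [n] is replaced by
    the number congruent to it in the interval from N + 1 to N + d. *)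
Definition representative d N n := if n <= N + d then n else (n - N.+1) %% d + N.+1.

Lemma representative_reachable g d N m n : 0 < d -> m <= N ->
  reachable g d m (representative d N n) -> reachable g d m n.
Proof.
rewrite /reachable /representative => d0 mN; case: leqP => // nN.
case/orP=> [/eqP|/and3P [-> _ dv]]; first by lia.
apply/orP; right; rewrite /=; apply/andP; split; first by lia.
have -> : n - m = (n - N.+1) %/ d * d + ((n - N.+1) %% d + N.+1 - m).
  rewrite addnBA ?addnA -?divn_eq; lia.
by rewrite dvdn_addr // dvdn_mull.
Qed.

Lemma representative_mod d N n : 0 < d -> representative d N n = n %[mod d].
Proof.
rewrite /representative => d0; case: leqP => // h.
by rewrite modnDml subnK //; lia.
Qed.

Lemma representative_id d N n : representative d N n <= N -> representative d N n = n.
Proof.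
rewrite /representative; case: (leqP n (N + d)) => // _ h.
by have := leq_trans (leq_addl _ _) h; rewrite ltnn.
Qed.

Lemma representative_range d N n : 0 < d -> 0 < n -> 0 < representative d N n <= N + d.
Proof.
rewrite /representative => d0 n0; case: (leqP n (N + d)) => h; first by lia.
by have := ltn_pmod (n - N.+1) d0; move: (_ %% d) => r; lia.
Qed.

(** The condition on a triple of representatives that the hypotheses on the
    original triple leave: v is known modulo x only if neither the number of
    ones nor that of lengths x + 1 exceeds the bound, and likewise modulo
    x + 1. *)
Definition required x N (t : nat * nat * nat) :=
  let: (a, b, c) := t in let v := (a + b + c).+1 in
  [&& x.+1.*2 <= v,
      [|| N < a, N < c | coprime v x] & [|| N < a, N < b | coprime v x.+1]].

Lemma required_representative x N a b c (v := (a + b + c).+1) :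
  0 < x -> x.+1.*2 <= N -> x.+1.*2 <= v -> coprime v x -> coprime v x.+1 ->
  required x N (representative 1 N a, representative x N b, representative x.+1 N c).
Proof.
move=> x0 hN vx cx cx1; rewrite /required; apply/and3P; split.
- have [ha|ha] := leqP (representative 1 N a) N; last by lia.
  have [hb|hb] := leqP (representative x N b) N; last by lia.
  have [hc|hc] := leqP (representative x.+1 N c) N; last by lia.
  by rewrite (representative_id ha) (representative_id hb) (representative_id hc).
- have [ha|//] := leqP (representative 1 N a) N.
  have [hc|//] := leqP (representative x.+1 N c) N.
  rewrite (representative_id ha) (representative_id hc) /=.
  rewrite -coprime_modl -addnS -modnDml -(modnDmr a) representative_mod //.
  by rewrite modnDmr modnDml addnS coprime_modl.
- have [ha|//] := leqP (representative 1 N a) N.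
  have [hb|//] := leqP (representative x N b) N.
  rewrite (representative_id ha) (representative_id hb) /=.
  rewrite -coprime_modl -addn1 -addnA -modnDmr -modnDml.
  rewrite -(modnDml (representative _ _ _)) representative_mod // !modnDml modnDmr.
  by rewrite addnA addn1 coprime_modl.
Qed.

(** The bound on the profiles makes a representative beyond [N] reachable only
    by growth, which then also reaches what it represents.  Growth keeps [b]
    modulo x and [c] modulo x + 1, so a triple is compared only with the few
    profiles that have its residues.  Conditionals rather than connectives
    skip the other triples, since evaluation is by value. *)
Definition covered x N (qs : seq profile) :=
  all (fun q : profile => [&& q.1.1.1 <= N, q.1.1.2 <= N & q.1.2 <= N]) qs &&
  all (fun r => let qr := [seq q : profile <- qs | q.1.1.2 %% x == r] in
    all (fun s => let qrs := [seq q : profile <- qr | q.1.2 %% x.+1 == s] in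
      all (fun a =>
        all (fun b => if b %% x != r then true else
          all (fun c => if c %% x.+1 != s then true else
            if required x N (a, b, c) then has (covers x (a, b, c)) qrs else true)
          (iota 1 (N + x.+1)))
        (iota 1 (N + x)))
      (iota 1 N.+1))
    (iota 0 x.+1))
  (iota 0 x).

Lemma covers_representative x N q a b c : 0 < x ->
  [&& q.1.1.1 <= N, q.1.1.2 <= N & q.1.2 <= N] ->
  covers x (representative 1 N a, representative x N b, representative x.+1 N c) q ->
  covers x (a, b, c) q.
Proof.
case: q => [[[a0 b0] c0] [[ga gb] gc]] x0 /and3P [/= qa qb qc] /and3P [ca cb cc].
by rewrite /covers !(representative_reachable _ _ ca, representative_reachable _ _ cb,
  representative_reachable _ _ cc).
Qed.

Lemma covered_realizable x N (ps : seq (seq nat)) a b c (v := (a + b + c).+1) :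
  1 < x -> x.+1.*2 <= N -> covered x N (pmap (profile_of x) ps) ->
  0 < a -> 0 < b -> 0 < c -> x.+1.*2 <= v -> coprime v x -> coprime v x.+1 ->
  realizable v (nseq a 1 ++ nseq b x ++ nseq c x.+1).
Proof.
move=> x1 hN /andP [bd cov] a0 b0 c0 xv cx cx1.
have x0 : 0 < x by lia.
have req := required_representative x0 hN xv cx cx1.
have ain : representative 1 N a \in iota 1 N.+1.
  by have := representative_range N (ltn0Sn 0) a0; rewrite mem_iota add1n ltnS addn1.
have bin : representative x N b \in iota 1 (N + x).
  by rewrite mem_iota add1n ltnS representative_range.
have cin : representative x.+1 N c \in iota 1 (N + x.+1).
  by rewrite mem_iota add1n ltnS representative_range.
have br : representative x N b %% x \in iota 0 x by rewrite mem_iota ltn_pmod.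
have cr : representative x.+1 N c %% x.+1 \in iota 0 x.+1 by rewrite mem_iota ltn_pmod.
have := allP (allP (allP (allP cov _ br) _ cr) _ ain) _ bin.
rewrite eqxx => /allP /(_ _ cin); rewrite eqxx req /= => /hasP [q].
rewrite !mem_filter => /and3P [_ _ qps] cq.
have {}cq := covers_representative x0 (allP bd _ qps) cq.
move: qps; rewrite mem_pmap => /mapP [p _ pq].
exact: covers_realizable x1 (esym pq) cq.
Qed.

Lemma covered_has_realization x N (ps : seq (seq nat)) v (L : {mset nat}%mset) :
  1 < x -> x.+1.*2 <= N -> covered x N (pmap (profile_of x) ps) ->
  x + 1 <= v./2 -> size L = v - 1 -> finsupp L = [fset 1%N; x; (x + 1)%N]%fset ->
  coprime v x -> coprime v (x + 1) -> has_realization v L.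
Proof.
rewrite addn1 => x1 hN cov xv sL fL cx cx1.
have supp y : (y \in L) = (y \in [:: 1; x; x.+1]).
  by rewrite -msuppE fL !inE !in_fsetE orbA.
have := @perm_nseq3 1 x x.+1 L; rewrite /= !inE.
have -> : ~~ ((1 == x) || (1 == x.+1)) && (~~ (x == x.+1) && true) by lia.
have -> : all (mem [:: 1; x; x.+1]) L by apply/allP => y; rewrite supp.
move=> /(_ isT isT).
have pos y : y \in [:: 1; x; x.+1] -> 0 < count_mem y L.
  by rewrite -has_count has_pred1 supp.
have [a0 b0 c0] : [/\ 0 < count_mem 1 L, 0 < count_mem x L & 0 < count_mem x.+1 L].
  by split; apply: pos; rewrite !inE eqxx ?orbT.
move: (count_mem 1 L) (count_mem x L) (count_mem x.+1 L) a0 b0 c0 => a b c a0 b0 c0 pL.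
have xv2 : x.+1.*2 <= v by rewrite -(doubleK x.+1) in xv; move: xv; lia.
have ev : v = (a + b + c).+1.
  have := perm_size pL; rewrite sL !size_cat !size_nseq addnA subn1 => <-.
  by rewrite prednK //; apply: leq_trans xv2.
rewrite ev in cx cx1 xv2 *.
have [p hp lp] := covered_realizable x1 hN cov a0 b0 c0 xv2 cx cx1.
by apply: (hamiltonian_realization hp); rewrite (perm_trans lp) // perm_sym.
Qed.

(** * Encoding of paths *)

(** The letters a, b, c stand for steps by 1, x, x + 1 upwards and A, B, C for
    the same steps downwards; a digit repeats the letter before it, so that b3
    stands for bbb.  Words are separated by spaces. *)
Fixpoint split_words (s : string) : seq (seq ascii) :=
  match s with
  | EmptyString => [:: [::]]
  | String " " s' => [::] :: split_words s'
  | String c s' => if split_words s' is w :: ws then (c :: w) :: ws else [::]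
  end.

Definition digit (c : ascii) : option nat :=
  match c with
  | "2" => Some 2 | "3" => Some 3 | "4" => Some 4 | "5" => Some 5
  | "6" => Some 6 | "7" => Some 7 | "8" => Some 8 | "9" => Some 9
  | _ => None
  end%char.

Fixpoint expand (previous : ascii) (w : seq ascii) : seq ascii :=
  if w is c :: w' then
    if digit c is Some n then nseq n.-1 previous ++ expand previous w'
    else c :: expand c w'
  else [::].

Definition step x v (c : ascii) : nat :=
  match c with
  | "a" => 1 | "A" => v - 1 | "b" => x | "B" => v - x | "c" => x.+1 | "C" => v - x.+1
  | _ => 0
  end%char.

(* The space stands for the letter before the first one. *)
Definition walk x (w : seq ascii) : seq nat :=
  let s := expand " "%char w in let v := (size s).+1 in
  0 :: scanl (fun u c => translate v (step x v c) u) 0 s.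

Definition walks x (lines : seq string) : seq (seq nat) :=
  [seq walk x w | w <- flatten [seq split_words l | l <- lines]].

(** * Growable paths for x = 7, 9 and 10 *)

Definition paths7 : seq string := [::
"cabc9c4 bacBC9C3 bCBABC9C2 bCBaC9CB2 cB2ABC9B2 b2cB2aC8B2 C7B3Ab2CB2 bCB3C6B3AB b3CB3Ab3c5";
"b4c4Ab3cB3 CB4Cacb4cB3 b3CB9CaC cAb4CB9 B4ab5cB5 abc9c4A bcACAc9bC aC9Bc2B2A b2CAc9bAB";
"b2acB2ABC8 bcB2ab3c7A bAB3C5acB3C C4acB3Cb2AB3 b3CB3acaC3B3 c3Ab3cB3ab4 b4cACAb4CB3 b4CB4acaB4";
"b5CAb4AB4 cA2c9c2bA c9ACAbCAB C9acB2A2B cBab2c8A2B bAB2ABC7acB b3CAc6Ab2aB bAB2ABC5B2AbC";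
"bAB2aCBC2acB4C baBCacb5C2Bab aCB5A2cb3CB2 b5CA2cb3AB3 b5CA2b4aB3 a2caC9acB c9A2BAbCA";
"BAbCAc8A2B BCacbcbCbCAcACAc bABAbCAc7ba CacaCacB3CAcbCb cbCbAB3CacaCacB CacaCacB3Cb2AB2";
"C2acB3AbAB3CAB bCAcACb4aB2ab2 ca2cB4CAb3aB2 aCAb4aB2ab4C B2Ab2AB4cBabaB cB3ab3aB4A2B";
"caCacaCacBcaC4 bC2aC7a2CA2 cbC2BCacaCacaCac cBCacb2cACAcACAc bCBacb2cACAcACAc baBcaC4acBabaB";
"bCBacb2cA2BAbCAc CacBabaB3CAcbAB CacBabaB3CAb2aB baBabaB4AbCbcA baBabaB4AbCb2a ABAbABAb3cB2ab2";
"aCAbCAcACAc4AC caC4acBaba2Cac bABAbCAcACAc4A babcB2acaCacaCac ABAbCAcACAcbabcB";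
"b2ABAbCAcACAcbAB bab2aB2acaCacBab b2ABAbABAbCAcbAB BAbABAbCAb2AB2AB cabcACAcACAcACAc";
"aCA2cbacbCAcACAc CacaCacaCacB2A2B aCA2cbacbABAbCAc ba2b2CAcA2BAbCAc CacB3AbAB2a3cA";
"CacBabaBabaB2A2B ABAbABAbABAb2acB bCAcACAcACAcACA2 aC3acaCacBaba3 aCAbABAbCAcACA2C";
"ca2cBaba2CacBaba aCABCacBabaBaba2 acBabaBabaBaba2C BAbABAbABAbCA3B aCAbCAc3A3ca3";
"aCA4BAbCAcACAc CAcA2BA4BAbCAc CacBabaBaba4cA BAbCAbacbA2ba4 BAbABA4BAbCAba a4cA3bCAcACAc";
"caCacBaba5cA2 BAbCAcACA5Ba2 a2CA5BAbABAbC BAbABAbCA5Ba2 aC4a6bA4 CbcA6Ca5B bA5bCbcA6 bA5b2A6cb";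
"aC3a5BA6 A6cbA6bc BcBa5BA7 a6BCa7C A7cbA6b a8cBa6 cAcbC2B2Cb5C3 cAc2B8c2BC2 b8C2bc2AcbC";
"cB2ACb8C2bc B9BcbcAcbC cb3cB7aCB3 CB3ab3cB8 b3CB3aB9 C3b5C3acBCAB babAc2B3C4B3C c3B5c2AbcBab2";
"bacbCAb7C2Bc Cb8CAc2b2AB BabcB8cbaBC B3ACB3Cb7A b4aB7aCB3 c3bab2CAc4b2aB aC3B3C2B3A2cbC";
"BAbc2B3C3AB3aC caC2B2CAB4AbCB2 cbABAB3c2BCaB4 acb2cB6ab3ac B9abcAcbAB B3Ca2b4aB6";
"CAcACAcb2caCBc2BC bCAbac2B3C3Ac2A cb2CAcAcacB4c2A C2Ab4C2ABacBCAB BAbCb4a2CBc2BCa";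
"aCBCb5CBACa2BC aCBc2B6acB2A2 AcbABCb2AB4cBab b3a2cB3acb2aB2C ABAbCb3cB2ab2aB2 b2AB2Ab7CAcA";
"b2AB2Ab2AB4cBab b3aBab3CAb5A BCAcbC2BCacaCacaC CAcACAcbcBacbCbAC CBabcB2acBaba2CB2";
"b3aB2cbaBCa2cBab BAbCAcb3aB2ab2aB b3ABAbCAb2AB2Ab2 aCAbCAcACAc4aC2 c9cbac6 c9bC6AB babc9bC5";
"bac6B2c7B c5B2c7B2AB b2cB2c5ab2C5 cB3c3aC5b2CB2 bC4aC3b3CB3CB b3CB3Cb3C2aC4 cAcbC2B6cb2cbC";
"cBCB5C2B5CaC b4Abc3B4Cb3C cACB6Cb2CB5 cAcb5cB9 cAb9bCB5 b9CB6AB ABC9Cac5 ac6aCBc7B aC5BC4BC4BA";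
"cAC5bc6Bab2 Bcb2C6ac3B2aC b3C4b2ac5BCa Bcb2CAc2bC4b3AC aC2b3CBABC4b2CB c3B2AB3c2Acb4C";
"ab2C2bc3B4CAB3 cBC3b2ab3CBAB4 cb5aB5C2acB2 aCB6AbCB6C AB7AbCB6C bab6cBab7 C4a2bc5aC5";
"c3Aba2c5bC5 c3Aba2bc5BC4 c3AC3Bac4babcB b2c2b2CBA2c4AC3 C2bcAbacb3CAc4B bCB3ac3B2a2C3bc";
"aC4a2bcB3cb3cB bab4C3Ab2cbC2AB bCBaCB3Ab5c2AC cA2B5C2B5AbC cb3AB3AB4abcbC cA2B7AbCB5";
"bAB5Ab6cBab aC5Ac4A2BC4 ac6Babac5aC CacBcaC2BCAcbC2Ac2 aC5BAbc3AC3BA cACAcb2cBcaC2ac2BC";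
"aC3Acbab2C2BC4A BcaC2ac2BCacb3CAc CBabcBcBCacb2cACAc cAc5bcB2ab3acA acbCAc3B4ACaCB2";
"CacB3CAcbCbA2B2cB bCAcb3a2CBabcB2cb bCAcb3aB2ab2aBcBC cb4cA2B4AbCAbc B2A2cbABCb2AB4cB";
"b4cA2B4AbCAbcB b5AB5Ab2CAcA bCb4aB2ab2aB2ab2 a2b3cB6AbAB3 cBcaCacaC4Ac2AC2 CA3c3bC5Ac3A";
"c2ACbCAcACAcbC2Ac2 caCacaC2BCAcbC2Ac2 caCacBCBCAcbC2Ac2A aCAbCAcbC2Ac2ACbCB ba2C2ac2BCacb3CAc";
"CacB3CAcbC2Ab2a2C aCA2cb2cB2cbaBCacb B2Ab2CBAbcACB3acA b2a2CBabcB2cb3ABA aC2AcbC4acaCacaC";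
"bcACAcACAcbC2Ac2AC bC3B7C3b2caC bc2BCaC2B9C2 cBCB8Cb3C2aC cAc2B3cb9cB cAb2C2b3CB9 bCB9B5CaC";
"b9b5cB2aC bCB9B6AB cb2cB3C4b2abAc2B ab2C3B7C3bcA c2b9bacbCAc2 cACB2c2Bab9c Bcb9cBacBCAB";
"bcBab9b3caC bab2CAB9B3C b3CB5Ab2AB6 baBCAb2c3BCacb3C2 cbCACbAB2Cb3c2BacB cAC2b2acbCACB7";
"ca2b9caCBc2B aCB8CaB2CAbcB bCBAbcbab9cA bAB9B2Ab2CAc b3CB9A2b2aB Cb3caCBc2aC2ac2BCa";
"BAbCBCBAB3c2Ac3AC cAC2aCB7AbC2aC acbCAc2Acb8cA ab7cAb2c2bCAcA cAc2B2ab9acA cA2B2AB8AbC2B";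
"aCAB9Ab2CBAB ba2b2ABAbCB9 CacaC2BCAcbC2Ac2AC2 BCAcbC2Ac2AC2BCacaC cBCA2c2AC2bcACB2Cac";
"b3CA2cbC2Ac2AC2b2a bCBAbcACBAbcACB2Cac CbCBacBab4aB2ab2a b3CAb2AB2Ab2CBAb2a B4Ab2AB2Ab2CBAb2a";
"c2aC2ac2BCacaCacaC2 c6bC5Ac7 c5BC6ac6b c6B2ac5BC5 bc5bC5Ab2C5 bAB2C5Bc4BC5 c4bC4bc5b2ab2";
"B2c4BC3Bc5B2AB B2Ab2C4bc3bC4B2 bab2C4Bc2BC3B2CB2 b2ab2cB2c3bC2bc3b2 bcBc2B2ab2cb2cb2c3B";
"b2cb2cb2cB2c3b2CBAB b2CB2CB2CB2Ab2CBCb2c B2ab2cb2cb2cb2cb2cB2 C6BaC7ac4 Ac6bC4bc6A c5bC5AB2ac5";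
"bc6Ababc5bC3 c4BC4Bc5Bab2A bc5b2ab2ac4bC3 c4BC3Bc4b2aB2ab B2Ab2AC3bc3bC4B2 bCBC4B2cbababc3B2";
"cBC3B2cbc3B2aB2ab2 b2cb2cbcAcbcB2acb2CB bC2B2Ab2Ab2CB2CB2C2b cb2CBAb2AB2Cb2CB2CB2";
"b2CB2AB2CB2Ab2CB2CB2 Abc6aC6ac4 c3BC5ac7A2B bC5AB2ac5AC4 c3aC5AB2AbC5B AB2Ab2C4Ac4bC4";
"c3BC4bAB2ac4ab2 b2ab2c3aC3Bc4B2A bc3ab2aB2ab2c4bC2 bc5B2cb2acbababcB cAc2B2C3B2AB2Cb2AB2";
"cb2CBAB2Ab2Ab2C2bcbC B2Ab2CAcbCbAB2Cb2CB2 b2ab2cB2ab2cB2abcB2C B2AB2Ab2CB2AB2Cb2CB2";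
"aC6ac3BC6a2 ac4BacAbc5aC4 c4a2BABac5bC4 C2Ac2AC2bcACB2CAcbC2 cb2caCBc2aC2ac2BCacb";
"ABCb2CB2CAcbC2Ac2AC2 BCAcbC2bcACBAbcACB2C bCBC3B2AB2Ab2AC3aC bCBABABAb2ac5b2CB";
"b2aBcBCacb2cBcaB2AbC bCBAbc3B2ab2aB2c2Ab bab2CAb2CB2AB2CBCaCB bab2C2B2CB2AB2CAb2aB";
"cb2cB2ab2aB2ab2ab2cB b2aB2ab2cB2ab2ab2cB2 CAc7A2c5bacA caC2BCAcbC2Ac2AC2Ac2";
"cBCBCAcbC2Ac2AC2Ac2A caC2BCAcbC2AbCAc2aBc CB2CAcbC2Ac2A2BCAbcB BCacb2caCBc2BCa2cbAB";
"bCBacb2cB2cba2C2a2bc bAB2acb2caCBc2BCa2b2 baBCacb2caCBabcB2ab2 bCBacb2cB2ab2aB2abcA";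
"B2Ab2AB2Ab2CBAbcACB2 B2Ab2AB2Ab2CB2CAb2aB B2Ab2AB2Ab2AB2Ab2CB2 cACAc4aC2ac2BCac2A c6B2AC6b6";
"C5Ab8C6b bC5bc5aB8 bC5b9bAC4 cB9B3c3aC4 cB4cbcB8c3AC bC3bc3aB9B3 bC3b9b5AC2 C2acB9B7c b9b8C2aC";
"cAb9b9C aB9B9cB C4Ac5abcB7c bC5Ab7AC5b B9c4abcAC4 Bc4BcbAC3Ab8 BABC3aC3BCb9 aCBc3Ac2B9B3";
"CAb9b3AcbC3b cAcAb9b5CBC Ac2B9B7aC b9b7CAcba AcbaB9B8 C4ACb8C4ACa AC5b8ABAC4 C2Ac4B9cBaCA";
"Bac3aB8aBc4B b9CBC3ACBabac CBc2babcB9abcA cAc2B9B4abcA b9b5CBA2c2A cB5ab2aB9aC AcAb9b8A";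
"C4Abac4abcB6a b8AcbACaC4aC2 c3a2B9c4aBA bac3BaB8ac3aB bC2AcAcAb9b2AC B9aCaCacBCaB3";
"ACaCacB9B3ab2 ACb9b6A2ca A2b9b6CAba C2Ac2AC2Ac2AC2bcACBC2 cbc2aC2ac2aC2ac2BCacb";
"CBabcaCBabcaCBc2BCaB2 aCBAbCBCAcbABCb2CBAbc a2CBabcaCBabcB6cB b4AB2Ab2CBAbcACBAbc";
"a2CBAbCb6AB2Ab2CB b4AB2Ab2AB2Ab2ACBcB aB2AbCb6AB2Ab2AB2 caC2ac2aC2ac2aC2ac2bc Cbcac9c9";
"bC9C9CAB bab2C9C9 c9c8B2AB2 cB3c9c6aB2 bcb3ab2C9C5 c9c3BCB3AB3C bC9C4b3AB4 c9caB4cb5C";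
"c9aB5Cb5C cB6c9aB5 b5AcbC8b6 bC8b7aB5 bC7b6AB7 b7AC5b8C bC5b7AB8 bC4b9aB7 caB9Cb9C aB9cb9bC";
"b8cb3ab9 ABCac9c9 bac9c8BCa AB2AbC9C8 bC8ABCAcbC6b AB2AbC9C5bCB Cb3AC9C3Ab3C bcBabcBabcBc9BC";
"C3b2ab4ab2C9 cbC8Ab4CB4aC cAb5C9Ab5 bC8Ab4AB6c caB6c6acB6 B5ab7C7AB b7aB6c5BCa bC4Ab6AB8c";
"cAb8C3Ab8 b9CAc2aB8 caB9acB9 B9abcAb9 c9c8abacA bC9C7A2BaC bC9C6Ab2a2C bcA2B2AbC9C5";
"BCBc9c4BababA bACAcbC9bcb3CA aC2b3ab3CBAC9 B3aCBAb3AcbC9 b4A2c2AC7b5C CABac8B4ab5 bC7Ab6aB4aC";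
"cB5ab6AC6AB Bc4acB7Ab5AC cAb7aB6ac4B aB7c4abaB7 b8cB8aCaCA cB9a2B8aC B9aCAb9A C9C6A2CBacA";
"a2CABAbC9C6 cbac9c4BacAba cAC6bAB2AbC7A c9B2AB3CaCac2A c9c3B2AB2ababa aC2Abab4ab2C9";
"b3C4ABCAcbC2Ac2Ab3 caB3ab5CAC6bcA cB2AB4AB3CBc3ac2AC c4Ba2B5Cb5CAcA C2bcb2cbCbAB2Ab2AB2AbC";
"B5a2c6B6aba C3A2b6CB7acA b6cB7CacaCBA2 aCacB8Cb7A2 b8A2b8AcAC b8A2b9ACa cA2cAC9C5AbA";
"C9C4A3c2Baba Ab2cbC9Ac2ACAcA A2bacBabac9c3B b2ab2C8Ac2ACAcba B2CbA2B2AbC8Ac2A bC8bcbA2bAB3acA";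
"b4C2aB3a2CABac6 bAB2Ab2CBAC6bAcbaB ac5B2AB4AB3CBacA cB6caC2Ab5A2c2A b5aB4abcaCBaC2acB";
"b6CAcA2c2Ba2B6 A2b5CB6abaB2CaC cA2BAb7CB7a2 a2cB7ab8A2B c2AC9CA3BCacaC bC5b3A3bacBabaB3";
"b2c2BCBcBc2aC2ac2aC2ac2 BCBcBabcB2ab2aB2cbaBCB2 B2Ab2AB2Ab3cBab3CbAB2 C2Ac2AC2Ac2bcBc2bCbC2Ac2";
"C2ac2aC2ac2aC2B2C2bCbc2B bCbc2Bcbc2AC2Ac2AC2bcACB C2ac2aC2ac2aBcBC2b2CB2C2";
"bCb2cBcB3ab5cACbAB2a b2AB2Ab6aBcBCBcBab3 B2ab2aB6Ab3CbAB3cB BCb2CBAbcb2cbaBCBcBab3aB";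
"BCBcBab3aB3abcB2cbaBCB2 bcBcB3AbCAb2cACB5ab2a B3Ab3AB3Ab3CB5abcA bAB3cBab3aB3ab6AB2";
"C3bc2AC2BCbC3acBc2aC2ac2 c2AC2Ac2b2c2aC2Bc3BcBC2Ac bCAc3BcBCBc2bc3AC2bcAC2a";
"c3bC4BC3ac3aC3ac3BcaC3bC c3bC3bc2ACbC3acB3C3ac3aC3 c2b2c2bC3Ac2b2aBcaBcBC3BcBc3BC2ac2b2"]%string.

Definition paths9 : seq string := [::
"cabc9c8 c9c7bCAB bCBABC9C6 b2c9c5AbcB b3c9c2AcbCbc CAc9b3C2B2cb BCb3acB3C9C cB3Cb2AB3C9";
"b3CB3Ab3c9 cBCAb4CB2Cb3c5 b4c7bab4CB2 b4c6Ab4CB4 c4b5CAB5cb3 b4cB5CAb5c3 C3B5ab5cB5 CB6CAb5cB5";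
"bab6CB4CB6 B6ab6cB6 aC9C8BA CBAbc9c6A BAbCBaC9C5 b2CBAbc9c4A B2AbCbc9c3ba b2ACBcB2ABC9C";
"cb3CAc9b3aB b3ACAc8b3CB2 b3CB3C7acaB3 c7Ab3cB3ab4 cAcbC2B5Cacb3cB2 b3cB4ab5c5A b5CAc4b4AB4";
"b4cB5CacaCB5 b5ACAcb5cB5 b5AB5Cb6CA b6cB5ab6A CABC7acaC7 C9C5acBaba AbcBa2C9C4B b2c5ACAc6AbcB";
"CABC9B2AbCBaC bAB2acb3CAc9 C7acaCB3Ab2CB2 cabc5Ab2CB2Ab3C2 aC7B3a2b4CB2 b3AB3Cb4CAc4AC";
"b3AB4Ab4CAc5 ba2C4B4ab4cB3 c3Ab5acB5Ab3 b4cB5acAb5AC b5CB4Ab6a2C b4cB5ab6A2B c9c4A2bC2a2";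
"c5A2BAbCAc8 bCBABC3acaC7ac cB2A2B2caC9ac ABAbCAc9babcB c9Ab2aBab3CA bABAb2cBab2c8A";
"bCAB4AbAB2aC7 cBaba2C5B3Ab2CB2 b2AB2Ab3cBab2c5A CAb3AB3Cb4CA2c2B aC3B4ab4cB4a2 ca2cB5acb4AB4";
"aCB4ab4cB6A2 a2cB5ab5aB5 Abc3ACAc9A2c cabcACAc9bacA cabcA2BAbCAc9 caBc2BacBaba2C7";
"BAb2acB2aCacaC7 aCacBCABC4B3A2cbC baBCBAb3CAc6A2B aCAb3cB2ab3cACAc3 c5A2BAb4acB3Ab";
"ba2C4acB3ab3aB3 bAB4ab2ab4CAc3A aCA3b4c2B5Ab3 b3aB3CBAb5CA3B ba2b4AB3Ab4cBab ca2caC9acBacA";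
"caC9acBaba3c aCacBaba2C8acB C8acBabaBaba2C BAbABAbCAc8A2B aCB2AbCB2aba2C6a aCA3bcBab3C2bcbcaC";
"C4acB3AbAB3aba2C ba2C4acB3AbAB3ab AcbABCb4aBab3CAcA ba2b4AB3Ab3CAcAC cB5Ab3AB4a3cA";
"BAb3aBab4cBab2A2B acA2cabc7ACAcAC CAcACAcACAcACAcbc2BC aCA3CAc7AbcBab cBab2c5ACAcACA3B";
"CacaCacBaba2CB2CAcbC C3acB3AbAB2aC2a2cA caCacaCacB3aCAb2AB2 bacBacBaba2CB2AbCBaC";
"aCAbCAcA2BAb3cB2ab2 cBabaBabaBabaB2C2b2a bCbcA2B4abaBabaBab b2aB2cBabaBabaBabaB2";
"b2aB2cb3ABAbABAbABA aCAbCAcACAcACAc4AC caC4acaCacBaba2Cac aC4acaCacBaba2CacB";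
"B2AbCBaCacaCacaCacaC bABAbCAcACAcACAbC2bA bCBABCacBaba2CacBacA bABAbABAbABAbCAc4A";
"b2ABAbABAbCAcACAcbAB b2CAcA2BAbABAbCAb2aB b2ABAbABAbABAbCAcbAB b2ABAbABAbABAbCAb2aB";
"CABCacaCacaCacaCacaC aCA2c4ACAcA2BAbCAc CacaCacaCacaCacB2A2B aCAb2a2b2CAcACAcACAc";
"cACAcA2BAbABAbCAcbac bacBacBabaBaba2CacaC ba2b2ABAbABAbCAcACAc bacBacBabaBabaBaba2C";
"CacBabaBabaBabaB2A2B BAbABAbABAbABAbCb2a2 ca2caCacaCacaCacBacA ca2caCacBaba2CacaCac";
"abcA2BAbCAcACAcACAcA aC3acaCacBabaBaba3 bCAcA2BAbCAcA2BAbCA2 aC3acBabaBabaBaba3";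
"ba3caCacBabaBabaBab acBabaBabaBabaBaba2C ba3cBabaBabaBabaBab cA3ca3BCacaCacaCac";
"CacaCacaCacBaba4cA cACA3BA2cA2BAbCAcAC aCaca3ba2CacBabaBab aCA4BAbABAbABAbCAc";
"ba2CacBabaBabaBaba3 BAbABAbABAbABA3CAba a4cA3bCAcACAcACAc aBA4CAcACAcACAcA2B BAbCAcACAcACA5Ba2";
"ABacBaba2CacaCa2BA3 CacBabaBabaBa3CA4 A4Ba3CacBabaBabaB BAbABAbABAbCA5Ba2 c4ACbA6Ca6";
"A6ca7C2BCbC ACBcBcBa6cA6 BcbA7Ca6B2C cA7Ba5B3AbC AB3a5BA7bcB a6BcaC4a7 CBa7cA7cbc A6bCbCbCA8";
"bCBa7CA7b2 BCb2A7b2A7 a6BA8c4A cBcBa7CA8 Ca8B2a7Bc A7b2A8bcB A7ca9cBc bA8ca8Bc bCbA7ba9";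
"a8BCa9C A9cbA8b A8bCA9A bc5BC2B4cbacb2CB b3C2bc3B4aC3b3C B3C3aB3cb3c4b3 cAcb3CB2Cb3c3B5";
"bC2b3cB2cb8caC B3C3AB4Cb4CB4 CBc2B4ab8cB3 B8Cb5C2aB4 B9Cb5CAb4 b9b6cAb4 b2CBAbc3B4C2Bc4A";
"baB3C3aB3c2BC4B2 bAB3C4B3Cb3Ac3b CB4caC4B2ab2cB4 cb8acAcbC2b3cB b9acbCAcbCb2cB b3AB8Cb4CAc2";
"CB9Ab3CB4ca B8Ab4ACb5C b5CAb4AB9 C3ac4b3cB2cbaB2AC bab2aB2C4ac4b3cB bACb3c2b4CBAbc3Ac";
"caC2acB3Cb2ABCb5C bCB4c2Aba2b3c3B3 cBCaCBabcb9acb cAb2AB9C2acB3 Bab9c2B2AB3aC cAb4CB7Ab4AB";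
"b9aB4acAb4 b2c5aC3B2AbCB2CA2 caB3C3ac4bab2CAB2 cB4c2Bab3C2bcAcA2C BACaCacBCAB7C2bc";
"b9acbCAcAcAcbC bAB2aCaCAb4c2b5C ac2ACb4cB3ab3aB3 Acb8cabACb4aB b9aB2ab4CAcA b9aB2ab4CAba";
"bCBa3C4B2ab2c5A c3aCB3acBacAb3C2aC ABCb2ABAbc2Babc3acbC aCAb2abcbcaCacbcb3CB";
"BacAb3CBAB2Ab3cAC3 aBACb2cab7acbCAc cBCaCAb3acb7a2b b8aBab3CAc2A2B acb7a2b4CAB2ab ACa2B3ab9aB3";
"cB2aC3ac4bABAbcA2C cAC4ac2BCacB2ABAbAB cb2A2c3b2abA3c4b2 cbABCb2CB2CacBaba2Cac";
"aCBa2CBacB2Ca2b5C2 BAbABAbCAcb3aBcBCacb cBabaBabaB3CAcbCbAB2 BAbCAcACb4aB2ab2aB2";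
"AB8AbCBaCacB2A2 BAbABAbCb4aB2cbaB2A ca2b5cBabaB3AbAB2 b2AB2Ab2AB4cBabaBab b5a2cB3AbAB3abaB";
"cACAcACAcACAcbc2BCacb cBCAbcACB2CacaCacaCac bCBAbcACB2CacaCacaCac b2cB2cbaBCa2caCacaCac";
"CAcACAcACAcb2cB2ab2aB b2cB2ab2aB2acaCacaCac b2cB2cbaBCa2cBabaBacA bAB2Ab2AB3CacaCacBab";
"b3ABAbCAcACAb2AB2Ab2 AB2abcB2acBabaBabaB3 b5CA3b2aBab3ABAb cACAcACAcACAcbc2aC2ac";
"cBCacbabcACAcACAcACAc bc2aC2acBacBaba2CacaC bAB2acbab2CAcACAcACAc cA2B2acBab4CAcACAba";
"aCA5BAbCAcA2BAbCAc c5bac9c6 c6AC8bc5b c9c5BC4BAB bac8BC5B2C4 b3C4bc4ac4BC4 c2bC9b2CB2C3AB";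
"B2c4B3C4bAc4BC2 c3B2AC3b5C4bc3 c3B2ABC3Bc4B5c2 c4b3cB5c3AcbC2B bc2BCaC3b3c4B6";
"B2cb2cB3C4BCb3acbC CB3ab3c3b2cB3C3B2 bc3bC2bcbabcB9 cB9B4c2BC2BaC b9b4C2bc2AbcB b2c2Acb2cB9B4";
"b9b7CB2CaC cAb9b8CB2 bab3cB9B7 C9Abc5aC5 Ac6Abc5bC7 Ac6AC6bc4bcB bAB2C4Ac4bC8 bc5AC5BAbc4bcB";
"b2c3aC3Bc7abcB2 b2c4bcB2C3BABaC5 c3b3c4bcB2C4aBAB Bcb2CAbCBaC5b2C3B2 cb3C4b3cB2c2AbacbC";
"B2AbCBaC2b3c5b3cB ABCBc3b2CAc3B8 cb2cB2ab4C4b2ab2cB b2CBAbc3B9Bc2A cAcbCAb9b2C2b3";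
"cBCacB9B3cbaB2 bAB3c2B9B2acB2 CB3ab3cB8ab4 b3cB6ab4aB6 C7Ac6A2BC5 ba2C6Ac4bC7 aBC5Ac5Abc5bC";
"bC2a2c8BC2Bc3ba bAB2C4Ac4b2C2aC4 cbcBab2c2bcAbc4aC4 bC4Acbac4BabcBcbcB bC3Ab3cB3c3Ac2AC2B";
"CAcb3ac4b3CB2CAcbC ba2C3b8CAc2bC3 cACB2c3b3cBab4ac2B caC2acB9BaCBc2B b2cBacBCAB3cbcB5aC";
"b4ac2aB4Ab3C2B2cb cb3cB9abcAcbAB bAB4Ab9CB2CaC b3cB8a2CB3Ab3 B3Ab3CB3a2B9 abc5A2c6AC6";
"C5ac5bACAc5ba bc3AC5Ac6a2bcB aBC3Bc4bacaC5acB aC4bc2bcabcBac5ba abc2b3c3AbcaCacBC4";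
"b2c3AC3B2AbCBAbc4A c2ab4CB2C4aCacBCAB BAb2cBabc3b3CBCaC2AC c3b3abcaCB2ABacbcB2C";
"cAcbCAcAcacB9cb b3aB3CacbcBab4C2aC cbcB6acb2acbCA2B3 CAb3aB2cb2A2b4CB3C ab3cB6ab4acb2cA";
"AB4Ab6CB3Ab3cA A2b3cB3ab3aB8 c4A3c6aC5acB C5BA3CBC4ac5A C4bcAC5AbC3BA3C ABC3ABaCAbCAc6BC2";
"c3Bac5B2cbac2ba3c aCACaCBc4B4A2cbC3 cBCAB2ac3B2aCAbCBaC3 aCBc2aC3BAb2CB3A2cbC";
"cBab4CAcAC2B3c3A2B b4acbac2BCB2AbC2BacA ba2b2CAbac3b3cB4ac caC2acB7aCB3abaB bCBa2b3cB5aCB3acA";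
"b4A3b3cB2cbaB3AbC b3AB4Ab4CAcbab2AB b3CA2B4Ab4Ab2AB3 aC5ac5aC5BA3 aCABC3Ac3bC6aca2";
"aBCacbabc3AC3Ac5A cbC2Ac2ACbCB2CacaCacaC caBaCAbC5AcAC3Babc CacaCacaCB2CAcbC2AbcBc";
"bcaCBc2BCacb2cACAcACAc cACAcACAcb2cBcaBcBCAbC BC4ABAbCBACBABCac3A cACAcACAcb2cB2cbaBcBCA";
"ab2C2AB2Ab3cAC3Ac3A babcbC2A2BCacBCBAbC2AB CacBabaBcaB2AbCBCAcbCb BabaB2CbAB2AbC3acBCaC";
"baBCA2BCacBCBAbAB3C2B Babc2B2AB2A2BaCAbCB3C aC2Acb3aBab2cBab4aB B2Ab2AB2Ab2AB4caCacB";
"aCB3abcBabab3AB2AbCB BcBabaBcB2AB2Ab2AB2Ab2 b2aBab3CAb2AB4Ab2AC bABAbCb4aB2ab2aB2ab2";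
"cBabaB4Ab2AB2Ab2AB3 CAcACAcACbCAc4aC2ac2 CAcbC6AcAC2a2C2AcA cbC2Ac2AC2BCacaCacaCac";
"CAcACAcACb2c2aC2ac2BCa CbACBcBac2bcACAcACAcAC caC2ac2BCacb2cA2BAbCAc cA2B2ac2BCacb3CAcACAc";
"BAbABAbCAbCAc2aBc3ACb cBaba2CacBCBCAcbCbAB2A CbCBacBacBabaBaba2CBCb bABAbAB3Cacba2C2acB3";
"b4CBA3B4abacbCAcA BcbcB2ab2aB2acBabaBaba aC2AcbC4acaCacaCacaC C2Ac2AC4acBaba2CacaC";
"bab2aB2ab2aB2acBabaBab CacBacaCacBabaB2CbA3B BabaBabaB2AB2AbCAb2a2C b3C4b3aBc5BCB4";
"b3C4aC3bcb5cB4 bc4B5cb2cb4C2aB2 b4CB6Cb5C4aC bC2bc3B5cb5aB4 b4CB7c2B6CaC cB7Cb5CB6aC";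
"bCB6CB7AB5C B7acb7CB6 b7cB7ab7 ab4C4b2ac5BCB4 c3B2AB4Cb4C4b2ac bAB2Cb4cBab4C2bc4";
"cBCacb6CB3Cb2C2AB2 ABC2b5C3Ab4CB5 b3CB5Cb6cACB2Ca Acb6CB5Cb6cA b6CAb6C2b6A b7CB6Ab6cA";
"b5aB7AbCB7 b2c2b3cACB3A2C4Bc2B bCBAC4Bc4B4ABAB3 c3Ab3ab4C3acBCB4 cAb3CB5CacBC3aB4";
"b5cBab4C2aC3b3aB b4A2b5CAc2bC2b5 b3CAc2Ab5AB6CB2 b6CAcb6ABCaB4 b6CB5Ab7a2C b4AB7acB7AB";
"babc4bc4bcB2ab3acA b4acBCaCBc2BC3acB2AB cbcB2ab3cB2cba2C3Babc aB3cbaBacB2cb3C2bAc2B";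
"bacbCAc2b4acb4CB3A cA2B5C2acBCB4Ab4 cAb5CAbac2B4ab5 b4CB4acB6abaBCA cAb2AB6Ab6CB3A";
"b3cB6AbAB7A2B cAb2CAc4B2AB2ababc4 ba3bcB3cb3cBac3aC3 cb2cB3a2c2b2CBABAbc2AC";
"ca3bcB2CAB2c2Bab2cB2cb cACAbab5CAb4cbCACb cAb2cA2B6c2B3AbCAb b4c2BCB3aB2AbCAB2aba";
"bCB3ab2cB4A3b2ABCb2 baB4ab5cB4ab2a2C BAbCB2Ab4AB5a2B4 cAc3abcbcaCacB2ABCAbcB";
"cabcBab2cAC4bcACB3A2 bcB2ab5CAbac3AC2AcA Babc2BCB5A2cb2AC2AcA cb3A2b4cb2CAcACB2acA";
"bAB3AB3CacBCBAbCBa2CB b4cbABAbAB2aC2acB4A bABAb3CB3a2CABAb4CB a2B3cbaBab3CAb4aB3";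
"cACAcACAcbc2aC2ac2BCacb bCBA2c2AC2bcACB2CacBacA A3c2bcB2Cacb2a2Cacb2cB aCacB4A2cbC2bcACBAb2a";
"AB2c2aC2a2bcB2acBabaB3 b3ABAbCA2cbABCb2CBAbcA AB2abcB2cbaBCa2cBabaB3 BAbCAb2CBAbcA2B2Ab2AB3";
"BAbCAcb3aB2ab2aB2ab2aB BAbCAb2AB2Ab2AB2Ab2AB3 caCacaCacBC3Ac2AC2Ac2A cBCaC3b4c2b5CBC2B2";
"b3c3BC2B7aC3b2cB c2b6c2b8c2BCaC c2b8cbC2B7CaC cBCB8C2B8CaC cAcb8c2b9cB cab9cB2cb8c cb9cB2aCB9";
"b8cB9CaB4 b9CB9aB4 b2CB2CBc3aC4B3ab3cB c3BCaCaCBc2b8CB3 CB7Ab2C3B4C3bcA b3C3acB3c3b3aB6";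
"bAB7Cb2CAc2b6c2 b6cb2cB3Cac2b5aB b8CB7Ab2C2bcA cAcb8cBab9b AB9BAbCB9C B3Ab3CB9ab6";
"C2bAB3C4B4Ab2C3acB cab5acbCAbc2bC3B4C cBCB5Cb2C2AB5AC2ac bC3B3Ab6cB3c3A2B bCAc2b6c2Acb7aB";
"c3B2AB3cbabab3cB6 b4Ab3ab2c2B4CBAbcb2 BAbCB8CAB8AC caB3AB7Ab8cB bAB8Ab9cBab";
"bCBacb3C2Ac3acB2AB2c2B aC3b2ab2cBab3C4aCB3 cb3aBc3b4c2acB2ABAbC b3acbCAc3B3CaCAB6";
"bCBABAbc2b4aB3cb2acbC cAc2B3aCAbCB6ab5 cBCAbcAbcBab7AB5 bab6aBc2Bab6cBab b4CB4ABacB2AB3aB4";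
"b6a2cB3AbAB9 c2bCAc2b4cA2B4CaC2Ac ca2b4cAbcaCac2b4c3B bC2A2bcBac3B4CbACAB3";
"aC2b2cbCAB4CAbab3CBAC CacBab2c2Ab3aBcab3cB3 AB6CBacB2CAcA2B5C CacBab7a2CB7AC";
"bAB2Ab3CBAbCB3Ab3cbAB aCB5Ab8cB2a3B2 b4aBab6CB3A2B3AB BCAcbABCAcbC2bcACB2CacaC";
"cb3a3CAB2C4ac3B2CAc ba2c2b3CB2CAcACAc2abcbc BCacbacB3AbCB2C2bcAcA2C aCacBCABCb3Ac3b4ABCa";
"bCBABAb2ab2C2ACB2cbaB2AC Caca2b6AB5AbC2bcA b2cBab4aBab3CA2B3CbA aCacBab7aB8A2 B7AbABAbCB6A3B";
"CAcACAc2bcaCBc2aC2ac2aC2 CacaCB2CAcbC2Ac2AC2Ac2AC CacaCB2CAcbC2Ac2AC2AbcaC";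
"C3AcACAcbc2BCa2b3cbA2B bCAcAcbCAB3aC2Abab3C2a ba3CaCacb3CAcb3cbCAb2 bacbABAbCB3CbA3c2Bab2c";
"BAbCAc2ab5a3cb5cA aCAb3cB2ab2aB2cbaBCa2b2 A3cbCAcA2B6Ab7 bAB4Ab5cBabaB2a3B2";
"cACAcACAc4aC2ac2BCac2A bCAcACAc3ba2C2ac2aC2ac2 CbAB2AbCAc2AC4acaCacaC ABAbCA2cbC2Ac2A2BCb2CBAB";
"cab2C3B8Cb3C4bc caC2Bc3b9b4c3B b9b5c2aC2Bc2BC2 bC2bc2b9b6c2AC b9b7c2bC2bcAc b9b6c2b2ACBcBC";
"c2b9b8abcB2C bCB9B9B2CaC b3CB9B8CaB2 bab9b9b3cB C4B9C4b2abacbC BC4B8CBABABCb2c3";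
"C2Abc2bC2AB9B4C2 bcBab9cB3c3aC2B2 B2C2B9B6C2aCaC cAcab9b8c2BC CBacBCAB9B8C b9b8acbCAbcB";
"b2CAb2AB9B8C aB2ab9b8cB3 cAcbC3Ac4b9aBcb C3bCB9BAbC3BcacA cbab2C3AB9BC3Abc caC3B9B4AbC2aCB";
"B9B5C2AcAcab2C2 acbCAc2b9b7ac bcAc2B2ab9b5cba BAbCB5Cb3CB8A2B aCB9B9A2bcB bCB9Ab2AB8AB";
"babc2bcB2C2ac2b6ac2AC cba2C4B9AbC3aCB aCAB9C2Bc2BCaC2BAB cBCaC2ac2b9bcaBAB2 Cb3CB9ACABacBCacb";
"ab9bcAbcBab2cbABC2 Bab9aB2cb2Ac2B3ca AB9B7ABCacBCA bab2CAB9B5Ab2AC b2aB2ab9b2aB2acB3";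
"cbc2ab6ac3AcaBC3BAB bac2Ac3BCBCBAB2AbCB3ABC c2Ac2bCAcbab9abcAC CBabab2acAcb8ac3bC";
"aba2C3bAbc3Bab9b abACBaCacab9bcB3c Ba2cAcb9b5a2cBC cb5aB2ab8a2CBacB b9b6a2cB3A2cA";
"ba2b5aB2ab9cBab CAcb2caCBc2aC2ac2aC2ac2BC cB3CAcbC2Ac2AC2Ac2AC2bcA CBabcaCBabcaCBc2BCacb2cAC";
"BAbCBCAcACBAB3cbcBcac2AC C3B2cba2C3B5ABACa2cB bac3b9a2c2ACAc2ab ab8ac2B2ACaCac3bAB";
"cb6aBcbcBabab2CA2BCAc bC2b2abACB7AbCAb2a2C baBacAcbcb9a3bcb2 ba2CBAB9B3Ab2CAcA";
"Abcab9aB2ab4acbA b2aB2ab9cBabaB2A2B cACAc2bcaCBc2aC2ac2BCac2A CacaBcaC2ac2aC2ac2BCacbcB";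
"BCAcbC2Ac2A2BCAcbC2BCacaC cACAbCAc2aBcbcaCBc2BCacba bc3AC3A2bcBacbabcBab2cA";
"CBabcB2cba2C2ac2BCa2b3cA b3CAb2AB2A2cbC2Ac2AC2b2a b2cACAb2AB2A2cbABCb2CBAbc";
"acBCaCAbCBaBAB7Ab2AC CAb2AB2Ab2AB2Ab2CBAbcACB2 b3CA2cbABCb2AB2Ab2AB2Ab2";
"b3CAb2AB2Ab2AB2Ab2CBAb2a b3CAb2AB2Ab2AB2Ab2AB2Ab2 aC2ac2aC2ac2aC2ac3bCAcAC";
"CBA2c2AC2bcACB2aCAbCAbcaC ABCac2aC2ac2aC2acBab4aB aC2b2AB2Ab2CB2aCAbCA2c2aC";
"CacB2ABCAcbABCAcbABCAb2aB B4Ab2AB2AbCAc2AC2Ab2a2C ba2C2B2Ab2AB2Ab2AB2AbCAc2";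
"bAB4Ab2AB2Ab2CBAbCAcba2 bAB4Ab2AB2Ab2AB2AbCAcba B2ab2aB2ab4aB2acBab2A2B C8bc9AC7 Bc8BC8ac7";
"c7bC7AB2C8 bC7bc6bC8aB bab2C8bc6bC6 bc7b2ab2c7bC5 c4BC7B2Cb2C6BAB b2AB2C6bc5bC6B2";
"bCB2c6bC4bc5b2aB2 b2c5bC4bc5b2ab2cB2 b2ab2cB2c4bC3bc5b2CB b2cb2aB2c4bC3bc4b2cB2";
"B2AB2CB2CB2C3bc2bC4b2cB b2Ab2CB2CB2C2bcbC4B2cbcB bCBCbCB2c4B2cb2cb2cb2ab2";
"bC2b2cBc2B2ab2cb2cb2cb2cB2 bcB2C2B2CB2CB2AB2CB2Cb2CB2 b2cb2cb2cb2cb2cb2cB2ab2cb2 c6aC9C8BA";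
"bC7Ac9bac6 abc8bac7bC6 ac7B2cbac6BC6 c6aB2ab2c7BC6 bc6bC6Ab2AB2C6 c7B2aB2abcBc5bC4";
"b2c6bC5bc5aB2ab2 c3bC6B2cbabac4b2cB2 bcB2C5Bc3BC4B2CAB2ab Bab2cb2c4BC3Bc4b2ab2c";
"BcbcB2C5acBCABCB2CB2CB2 aB2ab2cB2cb2c3BC2Bc3B2cb B2AbCBaC3bcbC2B2CB2CB2CB2";
"b2AB2AB2CB2Cb2C4b2cBcbcB bcB2C2B2CB2AB2Ab2CB2C2b2cB cb2cb2cb2cb2cB2ab2ab2cb2cB";
"b2cb2cB2ab2cb2cb2aB2cb2cb2 aBC9ac6aC7 BAbC7Ac8AC6 aCAb2C8ac6BC5 ABC6Bc5BC6A2c2B";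
"baBCAC4bc4bC7acBC C5bc5ab2C7Ab2aB Bab2A2C5Bc5BC6B2 b2c5AC3bc5BCacB2ab2 cbac4b2cB2ab2abc5BC3";
"bCBaC5Bc3BC4b2AB2AB2 b2CB2Ab2CB2C3BACaCBc4bC bCb2AB2AB2Cb2C5aBcbc2BC";
"cb2CBC2BcBCAb2ACbcbC2B2Ab2 B2CB2Ab2AB2AB2C3Bc2BC3B2 babcBab2AC3b2CB2CB2CB2CB2";
"b2cb2cb2cB2cb2aB2acbab2C2B b2cb2cb2ab2cB2ab2cB2abcB2C b2ab2cB2ab2cb2cb2cb2cB2ab2 AC7Acbac7AC6";
"cA2c9bABC5Ac5 aBaCAbC7ac5BC6 c5AC5BABCaCBAbC6 ab2C4aC4aC2b2c3bc4A c5bC5bc6baBab2A2";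
"c3BC3ABCAcAbCB2AB2C6 Bc5B2a2CBabaB2c5BC3 caC4BcBC2b2AB2AB2CAcbC3 bac4b2ab2ab2cB2ac4BC3";
"cBCABAB2c4b2cbcAcbc2B2AB cabcb2cB2cb2ab2aB2c4AC2b B2CB2Ab2CB2Ab2CAcbC3b2caC";
"bab2C2B2AB2CB2C2bcbC2AB2ab bCBCb2c3B2cb2cb2ab2aBab2A b2CB2CB2AB2A2cbABCb2CB2CB2";
"cb2CBAB2CB2AB2Ab2AB2CB2CB2 B2Ab2CB2AB2Ab2CB2CB2Ab2CB2 c6ba3c7aCac6 c5aC6AbcA3cbC6";
"ABCac6AC3Ac6baBC2 c6B2a3c5BC6Aba C6BA3bcBabac5bC4 bc6AC2Ac4Bab2ab2c3A c3bC4Bac4B2a2BcbcACAb";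
"c3BC6b2ababc4a2b2AB babc4B2cbaBCa2b2c4Ac2B bCBaC2B2CAcbCbAB2C3acBCAB cab2caBABacB2cb2abc3BC2BC";
"B2AB2CB2AbCABC3B2cbabc2aC ABac3b2cb2cb2cB2cb2a3bcB BCacB2cb2cbaBCa2b2ab2cb2cB";
"bCBAbc3b2cB2aB2ab2ab2ab2c b2AB2Cb2CBAbcACB2AB2Ab2CB2 B2ab2ab2aB2cb2cb2cb2acB2AB";
"b2AB2CB2Ab2CB2AB2Ab2Ab2CB2 c2aCac6AC4A3BC6 c5bC6AcA2BC6A3 CBAbcA3cbC6ac3aC5";
"c2aC2ac2aC2ac2BCacb2caCBc2 BCAcbC2Ac2AC2Ac2AC2bcACB2C bCB2C4Abac3bC3A3cbCAc";
"aC2b2CB2CAcbC2Ac2A2BCAcbC2 c2aC2ac2BCacb2cB2cbaBCacba aBcBCAbCAcbC2bcACBAbcACB2C";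
"cb2caCBabcaCBcBacBacbCbACb aC2AcbABCAcbABCb2CB2Cb2CBA C2bcACBAbcA2B2Ab2CB2Cb2CBA";
"cb2cB2ab2a2CBabcBcaBcBCAbC bc2BCaC3B2CB2Ab2CBA2B2aba C2bcA2B2Ab2AB2Ab2CB2Cb2C2a";
"bCAcbCbAb2AB2CBAbcA2B2Cb2C baBCacb2cB2ab2aB2ac2b2CBAB bCBABAB2c4B2aB2ab2aB2ab2";
"BCb2CB2Cb2AB2Ab2AB2Ab2ABCa b2cB2ab2ab2cB2a2CBabcB2ab2 bab2CAB2CB2Ab2AB2Ab2AB2Cb2";
"b2AB2Ab2AB2Ab2CB2Cb2AB2Ab2 b2cB2cb2aB2ab2aB2ab2ab2aB2 c3AC3BA3C7AcAC2Ac2";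
"C2ac2aC2ac2aC2ac2BCacbc2AC cBCBCAcbC2Ac2AC2Ac2AC2Ac2A cBacaCBCbAC2Ac2A2BCAcbC2bc";
"caC2BCAcbCbCBAbcACBAbCAc2a ba2C2Ab2CB2CAcbCbCBAbCAc2a bCB2CAcbCbCBAbCAbCAcba2Bca";
"cBCacb2cB2ab2aB2cba2C2a2bc Bababab2C2A2b2CB2CBAbcACB2 bCBacb2caCBabcB2ab2aB2ab2a";
"b2cB2ab2aB2ab2aB2cbaBCa2b2 b2cB2ab2aB2ab2aB2ab2aB2ab2 Ac2aCBc2aC2ac2aC2ac4ACAc";
"C2Ac2AC2Ac2AC2Ac2A2BC3acB CAbCAc2aBcbcB2acBac2ACbA2B bAB2acb2cB2acBacBab2ACbA2B";
"aCA2c2abcB2cba2C2ac2BCac2A AB2A2cbC2BaCAbCAc2A2BCAbcB C8b9CBAC7 b9C8b2ac7 C7b2ac7B9B";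
"bC7b9b3AC6 cB9B2cbcB2c4aC5 Bc6B9B5ac5 C5ac4B9B7c c4aB9B7c5B c4babcB9B7c3 bC4b9b9AC3";
"b9b9AC3Bc3B CaC3BCb9b9b2 cB9B8cbcB4aC b9b9b5C2aC cAb9b9b6C aB9B9B6cB c6aC8b9CBA C5AbcACBCb9C6";
"c6bC6b9AcbAB c6AC5b9b3CBA B2ACBCb9AC4bc5B C4bAb7CBCb5C4Ab abc2bc2bcB9B4c3AC BAC4b9b7AC4";
"cacB8cbcB9c2aC AcbC3aC2b9b9 B9B9ac3bC2AB Cb9CBCb9bAcbA B9BcbcB9aCBab cB9B9B4aCBa b5AB2Ab9b7CB";
"b7CBC2BA2C5Bc5aC aCBAb9C2aC6bc4 ABCb9bAC6ac5B bcB9ac5ab2C5AB B3c2AcabcB8c3ab2C3 cac4B9B5cabac3";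
"b9b6C2aCABC3aC2 bC3Ac2ACb9b7AC C2b9b9CAc2A2C cB9B9ac3ACAB c2Ac2B8ab2aB9B bAbcAb9CBCb9A";
"AcAcaB9B9B4 bCb9b9AB2Ab2A bC7ac5aB8aCBa BcBc5aCBabcB7a2c4 C4A2b9AcbC6bAB BAC5b9AB2AbAC5";
"cAc4Ac2B9Bab2aBcbc c4B9B5acAba2c3 b8CBCb7CAc2A2CaC b9b7CBC2ACa2CAC aC3bcAb6AB2Ab9C";
"b9AcbA2c2ACb9 BCb9b8A2cabACb aCABa2bcB9B9B baBabcB9B9Ba2 BABAbcAb6C5ABCac5 BACa2B9cBCac5AC3";
"baBc5bC4A2b8ABCa aBABA2B2Ab8C5Bc4 cAb9b5CAc2AC3aCA cB2A2BABCb9bAcbC3aC c2BC3b9b4A2CBa2bA";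
"C2AcAb9b7AcbACA c2B9B7a2bAba2c2 b9b7A2bC2Bca2BA b9b9ABA2BCaca aB9Bab2aB9aCa ba2c6AC4ABA2b8C";
"c3aCacBcaB9c3a3cB bC3Ac2ACAcbAbcAb9AC bac2Ac4Ac2Bab2aB9a caCacaC2A2Cb9b4CBA A2C3ac2BabaB9B4aC";
"BabcB9cbcB3caBACa3 A2b5CBAbcAb9bCAcA Babca2CABacB9B6a aCAb9AB2Ab7CBA2 bcB5ab2aB4ab2a2b2aB4";
"C2Ac2AC2Ac2AC2Ac2AC2bcACBC2 cbc2aC2ac2aC2ac2aC2ac2BCacb CBabcaCBc2aC2ac2aC2ac2BCaB2";
"CbACbACbCBacBacBacB5ab2a CBc2BCa2b2aB2cbaBCa2b2aB4 BCAcbCbAB2Ab2AB2Ab2AB2AbCBC";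
"b2a2CBabcB2ab2aB6cBab2A B2A2cbABCb6AB2Ab2AB2Ab2 b2aB2ab2aB2ab2aB6cBab2A";
"c2ACAcbC2Ac2AC2Ac2AC2Ac2AC2 caC2acBab2aBcbcB2ab2aB2abcA AB2abcBcaC2acB5acBab2A2B";
"A2BCacBabcB6ab2aB2acbAB B2Ab2AB2Ab2AB2Ab2CBABCAb2aB cACAcbCbAB2Ab2CBAbcA2B2AbCA cbac9c9c7";
"bC9C9C7AB C9C5bcbC8ABC b2ab2C9C9C5 c7BCBc9c5B2AB cB3cb3AC9C9C b3cB3c9c9abc b2ab2C9bcbCbcbC7";
"Cb5C9C8Ab4 c9c6aB5Cb5C c2AC6bcbC6b5cB4 B6c9c5BCaB5 cB6c5BCBc7aB5 b7aB6c9c4B cB8c9c2aB7";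
"b7CB8c9abc b8AC9b9C cB9cb9AC7 b8AB9Bc8B b9baB9c7B cB9B2c5aB9B b9bCBAC3bcb9b cB9cb9Abcb3cB";
"b9b2CB9B4CaC b9b4cB9B3aC b9b4CBAb9b3 abcAC9C9C6 ac7BCBc9c6aC c9c9c4BCaBAB CABac3BCBc9c8B";
"aCBAbC9bcbC9bc c9BCaCB3AB2c9 cB3acbCb3AC9C7 B4aC2ac9c7B4 cb3ab4ab2C9C7 c9caC2ac3B5cb5";
"B4cacbCAb4C9C2bCB b6C3Ac2AC9b6 c7BCBc4Bab2aB5Cb3 cbCABCb3ab2C8b4cB3 b7CB8c8aC2a";
"b5CB7CBabcaCBc5BC aCBc8B9Ab7 b7aB6c8B2AB3 b9cB9c5aCBA b9baB9c5BCa baBCAbC3b9CB9 b4aB3c4B7ab8";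
"b9cB9BCB3ABaC b9bCB9B3acbAB b9b4CAb9b3A AbC9C9C5AcA aCBA2cbC9C9C3 cB2c9aC2ac9caB";
"B2A2cbC9C9C2AB b2A2C9C9b3CAc cB3ac2ACb3AC9C6 b2AB4c8aC2ac8B b2AB2AbC5bcbC9C2AB b4AC9C5ABCAb4C";
"cAb5cB5ac9c2aC2 c9c3B2AB4AB3CBabc Cb5cB4ac9c2Bab2a aC2ac8BCaB6Cb6 c9BCa2B6Cb6AB CacB8Cb7A2C7";
"cB8cb8A2c2AC5 cB8acbac6aB8 b8aB7c6aB2AbC caB8Cb8CAbcAcb2c B9Ab9CBAC3bcA c3Bab2a2B9Cb9";
"caB9B2Ab9bCACb acB9B2cb9b2A2B cB8ab9Ab3AB4 c9c6aC2ac5aCBA aCBA2cAcbC9C9C cA2B2A2cbC9C9C";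
"ba2C2ac9c9Bab2 c2AbcbC6bcbC8AbacA CAb2ab3CBAC9C6AC cbC9ABCAbab3cAcbC4 ba2c9c5BCB3AB3ac";
"bCBA2c2AbcbC8bcb3C2aB B3Cb4cbC5A2BaCAbC6 b4CB4acba2bcaCBc9 caB3c9abcB3AB2acB3 B6abcAb6CAc2AC7";
"B3a2B2CBc8BCB5abaB b5cB5c3abcBabcB2CaCaC cAb8cB8ac4aC2a B6ab8ABCAcbC5AB B9a2C2AcAb9C3";
"ABCAcb9bCAc2aB8 b8ACBcB9Bac2A2B cA2B2acBCB9ab9 B9BAb8ACBAbCBAb b5AB6acB7Ab5A aCABAC9CAc2AC9";
"bCBAC9C8AcAC2a2 aCABA2BCAcbC9C8 b2aBaC2ac7aC2ac8B CBAC6AbacA2cbC6bcbC2 caC2ac9cBCB2CaBAB2aC2";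
"cAbAB3ac8BCacbac5B aC2bC7ABCb3ab2C4Acba abcB3ABacbac9BCBacbC Cb2cBac5BCacbac3abcB3AB";
"b2cbABCAcb2cbC5bcb2cACABa BAbCBAb2ab3CBAC9bAB2 babAcbC5bcb3ab3CBAbcACB C4A2Cb7Ac2B7acaC";
"bCAc2aBabcaCBc2B2AB6Cb3 ba2B6CB2cbac3BCa2cB5 bcBc3a3B6cb7ABAbC b7AB9c3a3b2CAc";
"cbACaCAbAB2Ab8CB7 B2ab2aB2CB3AB3CB2cB4Ab2A caB9aBABAb9bCA ba2B5Ab4CAb6AB6 aCAbca2c9aC2ac8";
"ca3c9c9acBaba c9c9Baba2CBA3 bABCa3CABac9c6BC cA2B2A3B2AbC9C7 aCA2Ba2c8BCBc6Bab2";
"AcbC7Ac2AC3bACb3aBacB aC2ac9aC2acB2AB4AB2 bC3bAB2AbC9bA2bacBab c4aC2ac2abcaCacB5Cb4A";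
"aCABAbCBA2BCAcbC6b3CB3 B3Cb4AB2AbCAbacA2cbC6 c6Bab2aB3AB3CB3ABac2A C6ABCA3b5CB6abaB";
"ca2b2CAC3Ac2Ab6AB7 b2CBAbcb2cbABCb2AB2A2cbABCb2 b2cB3CBabcBa2B3aCBAb4CAc bCAb7C2aB7caBabacA";
"b2AB2Ab2AB2AbCbcb2cbCbAB2Ab2 a2cB9cb9ACA2ca b7CB7aCBababaBabcA bABAb7CB7a2B2acbAB";
"b9baB8a2cB2A3B aCA3BCaca2c9c8 aCA2Ba2c8aC2ac8B C2ac2aC2ac2aC2ac2aC2ac2BCB2C";
"C2ac2BCB2CBc2aC2ac2aC2a2c2AC aCac7BCaBAB2c5aC2aBa c2AC9A2BaCAb2AB2AbC3 ba2cbCA2cbC9ABCb2ABCa";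
"cB3abacA2b2AC9bcACBA b2Ac2B3c2BCacba2C2ac2BCacba BaB2ab4Cb2C7Ac2A3BaC ba2bcaCBabcaCBc5BCaB3Ab2";
"aCBAbC3ACaCAb5AC2acB5 c3BCa3BcaB4cb5CAbCAba aCacB7Ab5A2bC4ABCA cB3aCBAb3Ab2ab3cACBAbCBAC";
"baBCAb2cb3ab3AB2AbABCb2C2a B8Ab6AcbC2A3B2acA B5acBab2aB2ab2a2CB6aC cB2A4b9aB8acA";
"b2A3B2abaB3aB5ab7C a4cbCAcACAcAC9C5 BCBcBcb3cbABCAcbC2Ac2AC2Ac2A bAB3c2b4AB2Ab2AB2Ab2AB2AbC";
"b2aBcB3AbCB3ab2aB2ab2aB2ab2 bcB2ab2a2CBabcBcBCB2CBAbCbcbaB cbCbAB2Ab2AB2Ab2CBAbcbcBabcbCb";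
"b2AB2Ab2CBAbCbCbcbaBab2cbABCb2 b2aB2ab2aB5cB2A2b3CbAB3cB B2ab2aB2ab2aB6Ab3CbAB3cB";
"cba2C2ac2aC2ac2aC2B2Cb2C2BcBac C2Bc3BC2acBc2aC2a2bcaCBc2aC2B2 aC2ac2aC2ac2BCB3CbCbcbC2BAbc2A";
"B3a3cBCB4aB5ab5aB5 b2aBcB3AbCAb3AB6ab2aB2ab2 b4AB2Ab2AB2AbCb3AB3Ab3AB3";
"b2CBAbcb4aB3cBabcB2abcbCbACbAB c2ab7AB6Cb3AB2AbCAb3aB BCBc2ba2C3ac3BC2ac2b2cbC2A2c2aC";
"CacBabaBab3CbCbCbCbACbAB2Ab3cbC a2b4ACaB2AbCB7Ab9aB AB2Cb3CB3CBAbcbCbCB2AbCA2cbcBcaC2";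
"bCB3CBAbcbCbACbACbABCBcBabcB2abcB2 cbaBcBCBAbCAbcbCbAB3Ab3CB3CBAbcb";
"b2aBcBcaB3Ab2CBAbCAb8AB3Ab3"]%string.

Definition paths10 : seq string := [::
"bC2aC9C9 c9c9bCAB C9C8BabcB c9c7b2CBAB c9c5b2c2B2AB b2c9c5Ab2CB2 cb4C2bc8bcAcbC c9cb3CB2Cb3AC";
"cACB4cb2cB3C8 b3CB3aC9CB4 b2cB4ABC9B4 c6b4cB4cb4AC c6b5CAB5cb3 b4cB5CAb5c5 c2bC2b6CAB5cb3";
"b5CB5aC4B6 B5Cacb7C2B5 b5cB6Cacb7 b6Acb6cB7 B6ab7cB7 bCAc9c9A aC9C8BACB bCBABC9C6ac";
"aC9C6BabcB2 b2cBab2c9c5A c9c4Ab2CB2Ab2 bcB2C2b3c9bacA b2CB3Ab3c9c2A b3CB3acaC9B3 B4Ab3CB3aC9";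
"cACBC5B4CAb3cB3 c7Ab4CB4Ab4 aC6B4ab4cB5 aC5B5ab5cB4 b5c3ACAb5cB5 b6CAc3b5AB5 b5aB5Cacb7C";
"b6CB6Ab6AC aB6ab6cB7 aBC9C8a2C aCABC9C6BAC bCBAbc7ACAc7 aCABC9C4BabcB cBCacb3acbCAc9";
"cAc2B4AbCBaC9 C9Bc2BacB2ab2aB bCB3acaC9B3AB caC6Bc2B4ABAb2cB babcB2C6B3ABAbcbC aC7B5A2b3cB3";
"b5CAc6Ab4aB3 b3AB5CAcb5CAc3 b5aB4cb5CAc2AC b3CB5CAbab6caC cAb5cB5ab6AC cA2B8Ab5CB4 bab6aB6acB5";
"aC9acaC7BA c9c6A2BAbCA b2acBCaC5acaC7 c9c4A2BAb2acB bCBC9CacBaba2CB bCBABacaC7Bc2B2AC";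
"bCAcAb2CB2Ab2c8A aC7acaCB3Ab2CB3 aCB3cb2cB3acaC5BA cACBC4acB4CAb3aB2 B2C6acB3AbAB4AB";
"A2b4CB4Ab4c5A aCAb4cB3ab5C2bAC c3Ab4AB5Ab5CA caCacB6Ab4AB5 b6aB4ab6CAcA cB3AbAB6ab4aB3";
"C3acaCacaC9BAC ba3caC9C4acB c7ACAbC2bcACA2c2B ba2b2CAc9ACAbC2 cAbc6bacbCAcACAb2C";
"ba2b2CAc9AbcBab c5ACAcAb2CB2Ab3caC bacb3CB2Ab2c5ACA2C bacb3aBab3CAc5bac b3aB2aC6acBabaB3";
"aCA2c4Ab4CB4Ab3 CB4Ab3CB4CABCa2cA b4cB3ab4cACAb2a2C bacB5Ab3CB4aba2C b3AB5abcb5CA3B";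
"bab2aB4AbCB4AbAB3 ACAc9ACAc3bacA A3BAbCAc9c4A bCBABC9Caca3cA acBaba2C9acBCAB";
"ABAbCAbC2bc5ACA2c2B aC3acaC3B2AbCBaCBabc CAc5Ab2aBab3CA2c2B c5ACAcAb2aBab4acB";
"b2c3ACAbacbABAbCAb2CB b3AB3Ab3CAcACAc3ba b2ABAbCAc3AbcBab4aB caCB4ab4cB4a3cA A2b4CB4a2BACaCB4";
"cB5ab5aB4a3cA BAb5aB3ab5CA3B aCacbA2CAc5ACAc5 caCacaC4acBcBcaCacaC cBCAbc3ACAc3ACAcACAc";
"acA2CbCAc4ACAcACbCbC c5ACAcACAcACAcbabcB C4acBcaCacBcBaba2Cac ca2caC5acBaba2CBc2B";
"BcBcBcaCacBcaC4a3bA aCA3CAbC2bc5AbcBab A2ba3BcBcBcaC4acBcB caCacaCacBaba2CB2Cb2CB";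
"aCacaC3acB2aCBabcb2AB aCAbCAcACAcACb3cB2ab2 b3CAcACAcACAc2Ab2AB3 BA4BAbCbCbCbCbCbCAba";
"bab2C2B2acaCacB2aCAbAB BAbCAcACbCbABA2b2AB2Cb ABCb2CbCbABAbABAbCbABA BAbABAbABAbCAcb3aB2cb";
"aCAb2AB2Ab4aBab3CAc B2Ab2CB3cBabaBabaBaba baB2A2b4AB3Ab3CAcA BAbABAbABAbCb4aB2ab2";
"bAB2a2cBabaB3AbAB5 cBcaC4acaCacaCacaCac CacaC9acBa2CA3 CBc2bcACAcACAcACAcACAc";
"AcbC2B2caCacaCacaCacaC cACAcACAcA2BAbCAcbc2BC cACAcACAcA2BAbCb2c2BCa CacaCacBabaBaba2CBC2bc";
"bcB2acBaba2CacaCacaCB2 aCacaCacaCacB4Ab2AB2 b2aB2acaCacaCacBabaB3 b2aB2ab4ABAbCAcACAcA";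
"baBCacb3ABAbABAbABAbC bAB2acb3ABAbABAbABAbC b2aB2acBabaBabaBabaB3 cACBC2acaCacaCacaCacaC";
"cACAcACAcA2BAbCAc4AC cBCa2caCacaCacaCacaCB2 cACAcACAcACAcACAb2CBAB bCBa2b3cACAcACAcACAcA";
"bABAbCAcACAcACAbC2bA2B bCBa2b3cACAcA2BAbCAcA baBCa2b4CAcA2BAbCAcA cA2BAbABAbABAbCAcbabcB";
"cb2a2CBacBabaBabaBabaB cBabaBabaBabaBabaB2cba b3ABAbABAbABAbCA2b2aB abc3ACAcACAcACAcACAcA";
"caCacaCacaCacBCABCa2cA caCacBaba2CacaCacaCBAC aCacBabaBaba2CacaC4a aCAbCAcACAcA2BAbCAbCAB";
"c3ACAcA2BAbABAbABAbCA ab2acbABAbCAcA2BAbCAcA bCABaCacBabaBabaBaba2C ba2b2ABAbABAbCAcA2BAbC";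
"aCAb2a2b2ABAbABAbABAbC ba2b2ABAbABAbABAbABAbC aCAbCAcACAcACA2CAcACAc ba3caCacaCacaCacaCacB";
"ABacaCacaCaca2caCacBab bCAcACAcA2BAbCAcACA3B aBCacBaba2CacBaba2Ca2C bABAbABAbCAcACAcACA3B";
"aCAbABAbCA3BAbABAbCAc cA2BAbABAbABAbABAbCA2C BAbABAbABAbABAbCA2CAba ba3cBabaBabaBabaBabaB";
"CacaCacaCacaCacBa2CA3 cBaba2CacaCacaCaca3cA CA3BA2cACAcACAcA2BAbC aCA3CAcA2BAbABAbCAcAC";
"bA2ba4CaCacaCacBabaB aCA4BAbCAcA2BAbABAbC CacBabaBabaBabaBa2CA3 cBabaBabaBabaBaba4cA";
"ABA4BAbABAbABAbABAbC A3Ca3CacaCacaCacBacA aBA4CAcACAcACAcACAba Baba2CacaCacaCaca4bA";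
"A2ba5cBaba2CacaCacB aCAbCAcA2BAbABAbA2ca3 aBA5BAbABAbCAcACAba aBA5BAbCAcA2BAbABAb";
"baBabaBabaBaba2Ca2BA3 a6cA7CbCAc4 a6BcBcaC4a7 A6ca8cBcBcBc A7CbCAbcBcbA6 bcB2a7cA7b2c";
"B3a6BA7bCbcA ab2CbA7Ba6B3 a7CA7bCAc4 A7Ca7CacBcBc cb2A7ca8CBc a8CBcBcBa7B b2A7Ca7BAB2c";
"b2cBab2A8Ba6 A7bCAc4A8 a8cA8cbcBc a7BCBca9CB cbCbA8b2A8 a8B2a8B2cb A7ba9C4a bA8ca9CBc";
"a8BcBcbA9 bA8b2A9cb A9Ba8C3a bA9ca9Bc a9BcbA9b A9bcaCa9 AcA9b2A9 a9BACa9a C9C3ABC9 BC9Ac9bC2";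
"c9baBC9Bc c8b2c9bCAB b2c8Abc8b2C c8b2CBABC7B2 bc6bC7B2AbCB2c c4bC8B2cbabcB3 C5B4C5B3c2AbcB";
"b3C2bc5b4c4AbcB C2ABC9Ac9 abc9ACbc9 ABC9Ac8bcB c8babAc8bcB bCBC7ac8b2aB b2CB2C7BAbc7A";
"Cb3c5b3CAc7bA C5B2ab2c7b2cB2a b2AB3C5ac6b2cB2 cab3c5aC3B2Cb2CB3 aBC9Ac9AC c8bABC9a2C";
"bCBA2BC9Ac7 bc7aC7BCAbCBa babcBab2c6AC8 C7BcBab2abc6ba aC7BabcB2ab3c5 Bab3CAc6aC4B3cb";
"c2bC2bc3aCB5Ab2C2aC b2c3AbcBab2Ac2B4C4 aCAbc9aC8a aC9acabc7ba c7AC8aBABAbC cAC8aBABAbCbc5";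
"Ab2CBCAbabc7aC5 b2cBabaB2C6Ac6A BAbAB2aC6acB3C5 aC3BaCBabcB2cb3CAc4 aC3ac4b4C2AB2abcB2";
"bCBAB3AbC2bc2bc2ba2cbC ACa2C9Ac7ba ABC6ac8bCA3C cBaca3cBC7bc5A bABAbCAc7ba2C6 C5B2AbC2Baba3C6";
"cbaBabcbCAbc5aC3BAC cBCacbab2abcBabc4AC3 b2cBabaBCAB2C4Ac2bcaC b3CAcACBaCBc2B3CA2c2B";
"c2b4abcBab3acbCAc2AC caC5ac5bcACA2c2aC A3BAbCAc7AC7 A2bc5AC7acB2acA c4A2BC5aC2acBab2cA";
"caC3ac3bAcb2caCacBCAB A2b2CAc5AC5B2abaB c4bABAbAB2aC4aCBAbC bCAbCBa3caCBABC3bcbcB";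
"aCAbcAc2B2aBCBABAbCBC2B cbcBabab4cAC3acB2A2B c5AC6a2caCacBacA C5ac6A3BAbCAcAC";
"BaCAbCAcA2c5AC5BA c4A4Ba2C6Babc2B CBAB2acAc2B2CacBaba2C3 BC2Ab3aB2cbcbCAcACA3C";
"BacBacAb2C2b2abcBabcA2C cab4CAc2Ab2acbABAb2cA ca3caCacaC2aC3ac4bC CBc2BCacaCacaCacaCacaCB";
"c2AC4aBaCacBacAb2CAcA ba2C3Ba3caCacB2C3acB Caca3C2acB3AbC2bcAbcA cA2BAbCAcACAb2CBAbcACB2";
"cACAcACAcACAcACbc3aC2a cBCacbabcACAcACAcACAcAC C7BC7aC8 bc7Ac8BC6 c7bc6babc7 C6bc6abc6bcB";
"bab2C9bc2bC7 c6Ac4B3C4bc2bcB b2cB2c7ab2C7bc bc6babcB2C4B3C4 c2bC5bcb3C4b3acBC c4b3c4b3c4b2CBAB";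
"c7aC9C5BA ABC5ac8BC7 c7bC7Ac5bAB c7B2c2Abc3bC6A bC2aBABC2Bc6BC7 c2bC7bc4Ab2C3Ab2";
"c4B2c5bC4b2abacbC C6Bc2B2ab3c3aC3B2 b2CAc6BCBc3b3cB2aC c2bC2AB4ac3B4C3bc2 C7BA2c6AC7";
"c7BC7A2BaC5 Cacbac6aCBc9B c5babc6bcabc5A bCBC6BC5Ac4babA c5B2cbac7B2ABCAc babcab2C4bc5B2c4A";
"c7Bab3C4b3abcaC bC2a2B2C3bc2bC3B4c2A caC2Ab4ac2BC2Bc3b4C c6ba2C6ac7A CAc6A2BC6bc5A";
"abc3AC7ABAbC7 Ac6BC4B2aC5BacA ABC5acB2C4Babc5A acb2caCBc6Babac5B c6Bab3C4bcAbabcaC";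
"b3caCBc6BababAcbC3 C4B3ac3b2cACB2AbCBaC CB3Ab3c3BacAb2C2bc2AC c6aC6a2BC5a2C c6bCA3BaC5ac5";
"aC5ac6A3bc4b2C ca2c3bC3Ac4bCABC2bcA aCABCBc5BC5aca2b2C CB3c2AbcaCacBC5A2c2B";
"CBc2bacb3CAc4AbcaCacB bC3acBabc5A2BC2b3aB cBCAB2AbCABABCABCb2C5 b2ab2CAcAb3CBC2acBCaCBC";
"aC6ac5aC4aBCAcA c5aC3ac7BacAba2 abc3A2BC5acaCacBC4 c3bC3Abac4BacAcabcaC";
"aCacBC3bcAbCBC2acBCA2C2 AcbaB2c3bC2bc3BacAcacA c3AC2bcb2CAb2C2aBABacaC a2C3bcACB2AbC3Bc2BabaB";
"ba3cb3CB2AbCAb2caCBc3 caCBA3c6aC3ac5A aC3ac4aC2BaCAbC4A2C ABABac3BC4ac3aC3aca";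
"caC3aC2aCAbCAcbcBabcAc2 caCBABAbCBCAcbc2Ac2AC2AC aC2BC2BAbC2Ac2bcBacAbacA";
"aCacaCBc2b3CBA3bcBac3 bCAbC2bACbAcbCAcACBABacB CB2Ca2C2B2AbCBaCAb2cbacA cACAcAb3aB2acBab4C2aC";
"aCA3BCacaC5Ac3AC4 c3AC3Ac3ACA3cbC3Aba bC2a3BC3Ac3AC3BaCa2C aCBc4BC4AbCBa4cA2c";
"bcaCBabcB2acaCacaCacaCB2 BaCacBCABAb3CB2Ca2C2AcA b3CAcA2BAbCA2cbC2bcA2B2";
"b2a2CBabcB2acaCacBabaB3 aCAb2a3b4CB2AbCAcAb3 b3ABAbABAbCAb2AB2Ab2AB2 aC2AcbC4acaCacaCacaCac";
"bCAcACAcACAcbcba2C2a2cbC bCBCbA2BCacBacaCacaCacaC cACBa2bcB2acaCacaCacaCB2";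
"baBCA2cbABCBCacBabaBabaB c6abc9c8 c6aBc7BC9 c5BC9C7BAB c7bC7b2C6AB c4bC5BCbAB2C9 c5BC6bAB3c7B";
"C3B2C5BC4Babc4bcB c5BC6b3ab4C5 C4b3AcbC5b5C5 cBC3Bc5Abc3B4Cb3C c7BC9ac6a bAC6Ac9bC6";
"c7BC3BABC5Ac5 bac5BC8ac6B2 bac4bC4Ac9b2CB c3Bac5BC6bAB3c3 aCBc5B4Cb2C4Ac5 b3cb3CBAC4Bc4aC5";
"c2bC3BCAB2c6b2cB3Ca bc5b2CBABC4B2C2AB3C c5BC9ac6a2C bac6Bac6aC8 c5bC5Ac9babA c5bC4AbC7bAbcaC";
"c6BC4ac4b2c3baba ba2C5B2Cb2C5ac3BC2 bC2aC3bcb3CBAbc3AC5 c4bC5Bac4B2AB3cba";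
"babcB2c3bacbCACBCb2C5 c3babcB2C5BCAb3caCB2 Ac5aC4BC6Ac5A aBC5a2C6bc4AC4 ab2C6ac3aC8BaC";
"aC6aBABC3Ac3bC5B C4AcAb3C4Ac6B2aC c3BC6ABCaBABAbC5B cBC3bcAc6b2c2ab3acA bCBacbac4bCbc4BabacbC";
"caB3aC2b2CAc2bC2bCBAbc3 CbAB4Ab3C3acBC5BaC C4Ac2AC6Ac6bacA C3Ac4a2C5ABC5acB cac5A2BC2bcAC5ac3B";
"bac4aC6ABCac4abcB bAB2acbac4aCac5BC4 aC3Ba2cbCAc3B2c3AcbC2B bcbC2BAbc3acaC2BCa2b2c3";
"bC2A2b2c2aC2Babc3acb3C2 bCB3AbCBCBC3aCAbc3A2BC bC2a2B4Cb4C4bcAcacA c5aC3ac5aC5BA3";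
"c5Babac5aCac6a2 abc3aC2aBCacaC3Bc6A Ac6BacAbAC5ABAbC3 ca2bc3A2BC2Ac2bC5Babc";
"Ab2C4aCABAbCBaCac5bC a2bc4BCB2AbCBC4AcbacA bC2Ac6B2aCAbCBaB2abac aC2b2c5Bab2aB2CABAbC2a";
"b2c3aCB2abaB2C2Ac2A2b2CB aCac6aCac4abca2c4 aC5Ac3babca3C4ac3 c5aCacaC2AB2A2C2Ac4B";
"cA3BC5AcACAc3Bac2bcB BCac2Ab2C2bcACBCAcAc3acA ca3b2CAc2baB2c2AcacBC4 ACBcBabcBcBCacb2cACAcACAc";
"CacaCacBcaBcBCacbaBCacbcB BcBCA2cbC2bcA2B3CacaCacB cACAcbcbAbcACB2aCAbCBCAcb";
"ABAb3C3acB4acAbac2aC2 AB3CacBC2Babc2baB2ACBacA cACAcACb3cB2cbaBCa2b2aB2";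
"CacBabaB3Cb2AB2Ab2CBAbcA b2AB2A2cbABCb2AB4cBabaB B4A3b2aBab3CAb4aB3 ca2BC3acaCac5AC3Ac2A";
"CAcACAcACAc2bcaCBc2aC2ac2 CAcACAcACAcbC2Ac2AC2bcACB c2aC2ac2BCacbc2A2BAbCAcAC";
"aCBA2cbC2bcACBCBcaCacaCac b2cB2cba2C2ac2BCa2caCacaC ba2BcaBcBCAbCAbCBCacaCacB";
"CAcACB3ab2a2cBCABac2b2AC bCAcACAcb3aB2ab2a2CBabcB bCAcACAcb3aB2ab2aB2acbAB";
"bCAcACAcb3aB2ab2aB2ab2aB b3aB2ab2aB2cbaBCa2cBabaB bABAbCAcb3aB2ab2aB2ab2aB";
"bABAbCAb2AB2Ab2AB2Ab2AB3 caC2ac2aC2ac2bcACAcACAcAC c2AC2Ac2A2BC3acaCacaCacB";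
"bc2ACAcACAcACA2cbC2bcAC2a bCBacba2C2ac2bcACAcACAcAC c2aC2ac2BCa2b2c2A2BAbCAcA";
"caCacBaba2CBCbAB2AbCAbcaC b2aB2cbaBCa2b2ab2CAcACAcA bABAbABAb2cba2BcaB2AbCAbC";
"ba2Bcb2ABAbABAbCAbCAb2AB2 cb2ABAbABAbCAbcACBA2c2A2B C3BAC9C9C3 c2bC3BAC9C9 c3bac9BC3Bc7";
"bac7BC3Bc9BC2 b2c2ab2C9C8bc BC3Bc9c3B2cbcAc2B b2c2ab3c3bC9C3bc babcB3c9c3B2c2BC2";
"cb2CBAB3c9c5B3 bCBAB3c9BC3B4C2 B2cb2Ac2B3cb4C9C c5BC3B5C3b3abcB2C c6aB3c3b4CB3Cb3C";
"b4ab2C7bc2b4CB3C bcbcBcb2cb3cB2cb3C4aB2 b4C2Ac4B5c2b4CB3 cACB6C3b3cB2cb5CB b5cB2cb6c2b5c2AC";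
"b4AC3b5CB5Cb5C caC2B5Cb9bCB5 cACB6Cb9bCB5 B6Cacb6cB9B cAb9b9CB5 b9b8CB6AB c9c7BC3ac4A";
"Ac4Abc3bC9C6 c9c7BC2BABaC3 C9Ac4Abc3b2c3bC Bcbc2bC9bc3bAc4A bC2BaCBc9c5B3CA cbC9Ac4AbCBCb2CB2";
"bC5bc3bC5ABCb2CB2CA b3C8Ac4Ab3c2B2Cb b4c3bC9b2abAc2B2 cb4c3b2c3bC4bcAbabcB Ac4AC2bcb3C3B4cb3cB";
"c2b3caCB3C3B5AbC2bc2 ab4c2bC2bc2b3caCB5C2 b2cAcAcbC2B6C2bcb5C aC4Ab4CB5C2b4cB3";
"B3c2Ab5CAcb4cbC2B4 b4CB4Cb5C3acB5a cBCAb4CB6cbaB4Cb3 b3Acb6CB5Cb6cA b4cAbcBab6cB9 aCB6Ab9bCB6";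
"b6cBab7aB9 c4AC9C6Ac3ba CacbabcAC9C9 bCBA2c4AC9C5bc aC4ac9cabcB2C3bc C3BAC9AbCBaC3bcbC";
"bCBAbc3B2cbac8aC4 bC2a2CAB2c3b4C9C c2bC2b2C3acB4C3Bc3a2C c3B2cb2AC6bcbacbCAbcB";
"c5BC3B5A2cbC2B3c2A CBc3AcbABCb4c3B3CAcbC B2cb2Ac2B4C3BaC4acB3 Bab3cB3cb4C3BAC5AB";
"B2aC3b5C3Ab4C2aCB3 CB6ab3c2BCB3C2acBCAB bCAc3b4A2BCB4cb3cB3 CacB2cb5cbC2B3Ab5aB";
"BAb2ab3c3b6CB5CAB cAb5aB3cb4CAb7C b9CAc2b5AB5AB b5cBab7aB8aC ba2b7CB5Ab9 aC4Ac3bC7Ac4AC3";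
"A2BaC3Ac2bC9C6 cAbcaCac9c7B2A c9cBC2ac3Aba2BC3B bC2aCBabac9c3B2aC2 abcB2ac9c2B2cba2C3";
"cb3C8Ac4AbcAbabcB aC3AbC2bcbC5A2CBCb3CB b3aB2c2Abab2C2Ac3bC6 bA2c2bcaCBCacbcB3c3b2CBC";
"cb3CAc2ab2C7b2ab3aB cBCacb3C3B5Cac2bcA2B2 bCBAb2CB4aC3ABac3B2cb2 b2cACB4C2acBab3caCB4C";
"aCBc2BacBCa2b5CBCb6 BAb5acB2AB2c2b6c2aC cB4CaCBaB6CacB2AB4 aCacBCB5Ab5CB4AB3 A2b6caCB5ab5cB3";
"b3a2b4CB2Ab9AB2C b6ABAb5cB4ab5A c3aC3BA3c4AC9C C2ac9BC3BaC4a2cA Cacba2C4AcAbc3bC8";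
"bac7aC4acBC3acBCAB bC2Ac3bC9ABCABCAba BacAbAc3bC9ABCAbcB bCAc3B4C3b2acA3C6 cAb2C3acB3c8a2B2Ab";
"cabc3B3AbCBaCAB2c3abc3 bC2bcAcab2C2b2ac2B4ac2AC cAcb2CBCB3aCAb4C2AC2acB";
"bCBCBabaBCAB2CbAcb3C3BAC CAbab3CBAB3aCBAb4C5 b4abcB2a2cb3a2CBc4B3 cb5c2B2ABacb5AB2C2A2";
"BAbCB5ab4acb2Acb3caC Cac2A2b5aB4ab5cB3 cBCBabab6AB3Ab6cA aCacB7Ab5AB5Ab2 b4aB4ab6CAb5A2B";
"cACBA2c4aCac8aC4 ac9c3aBaCAbC3acaC c9cBababAc2aCac4A A2BaCBc7aC4acBC2acB";
"c2A2cbC2bc2acaCBABac6B c2aC4ac3B2ACBAB3c2Ac2A a2Bcb2acbCAcACB2AbC8 cAb3abcBab3C8AcAca";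
"ab2C4ACaCAbABCb2CB3c2aC c5B2aCBabc3A2BAb2abcB2 aCAbcb2C3B4a2C3ABAb3c c2bABCb2ca3cBCAB2c2Bab4";
"ac2BCaCAB4acB5aCAbCB2 caC2BAb3ab2cB2ab5abc2A cB5CAbabAcbCAcb6A2B b3a2b4CB2AbCAbacb5AC";
"a2b3CBAbcAb3cB3ab3aB3 BAbcA2B7ab3aB6CA a2b2ABAb5cB4ab4aB3 aCABC2a2C4ac6aC4ac";
"CbCAcACbCAc4aC2ac2aC2ac2 cAC2a2caC4ac9Baba cBcBcaCacaC4Ac2AC2bcAC2a cA2C2acBCABAbC6Ac4AC";
"aC2ac2aC2ac2BCacbcbCbCAcAC CAcbC2Ba2c2aC4ac4B2acA cbC2Ac2AC2Ac2AC2BCacBabaBc";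
"bCBC2B2CacaCac2Ac2AC2AbcaC CBc2aC2a2bcBcBCacb2cACAcAC cACBac2Bac4A2BC2bcACAbcB";
"BCAcbABCAcbC2bcACB2CacaCac bCbcaBcaC2ac2BCacb2cA2BAbC caCacaCB2CAcbABCAcbCbCBAbc";
"ba2b2CAcbacbCAc3b2c3ACAB BcBCAbCbcACBAbcACB2CacBacA cbCbAB2AbCAbCBCacaCacBcaBc";
"AcbCAc4B2AB3aC2BABAbc2A CBabcBcBCacbaBCacb2cA2BAbC cA2B3CBc2bcBaba2Cacb3C2a";
"cAbAB4CAcb3CAcbabcaCacB BAbCAcb3a2CBabcB2cbaBcBCA BcBcBcB2AB2A3bCAb2aBcaBcB";
"aCAbCb3cB2cbaBCa2b2aB2ab2 ca2b5AB2Ab3caCacB2cbaB cBabaB3CAcbABCb2AB2Ab2AB2";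
"aCAbCb3cB2ab2aB2ab2aB2ab2 ba3CB6ab2cB3CaB2AbAB B2Ab2AB2Ab2AB2Ab2CB3cBaba bCBa3baBCAB5ab2aB6";
"BAbCb4aB2ab2aB2ab2aB2ab2 c2aC2ac2aC2ac4ACbCAcACAc AC9CA2CAc3BacAcacA";
"CacaCacaCBC2Ac2AC2Ac2AC2bc CAc2AC2Ac2AC2bcACB2CacaCac CacaCacBCBCAcbC2Ac2AC2Acba";
"Ac2AC2bcACBCbACBcBacaCacaC cbABCAcbC2bcACBABCacaCacaC cACAcAb2cB2cba2C2a2bcaCBcB";
"CacBabaBCBCAcbCbAB2AbCAc2A cbCbCBAbcA2B2AbCBCacBaba2C b2a2CBabcaCBabcB2ab4CAcA";
"aCacB4A2cbABCb2AB2Ab2AB2 b2aB2ab2aB2ab2aB2ab4CAcA b2aB2ab2aB2ab2aB2acBabaB3";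
"Ac2aCBc2aC2ac4ACAcACAcAC bCAcACAcbcba2C2ac2BCa2b2aB cACBa2bcaCBabcB2ab3cACAcA";
"b2cA2BAbCA2cbC2bcA2B2A2bcB cA2B2ac2BCacba2b2CAcACAcAC ABCacBabaBabaB2ab2aB2ab2aB c4aC9C7Bc5";
"c4BC4ABC9C7 C3BC9C8BABC3 c8bC5bc5bC4AB bAc9bC5b2C4bc3 B3c5BC8ac3BC4b c4ab3c4BC3Bc4b2c4";
"b2c7b2caCBc4bCbc4B Bc3BC4b4c3b3C3Ac4 c3B4c5BCBAB3c4bC3 c5BC7ac4aC8 bAC4Ac9c6bC4 c3aC7Bc5BC7BA";
"bC5b2C5bAC4Ac7 c3aC8Bc5B3AbC4 Cac3BC4bAB3c5BC6 b2AB3C9ac3BC3Bc3 c2BCaC3bcAbc9b3CB2";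
"bac2BC4b4c3b3C3Ac4 AB2c4b2cB3C7BcBCAbC c4abc9AC4Ac6 ac3bC3Ac9c7Ab c9AC4AbC4bc4aB";
"C8BAC4Bc2abcaCBc4 c3Bac4aC7Bc5B2AB C2bc2ACbc8AcbCAc3B3 cBC4ABC9B2AbC3BAB bc5BC4BCBC4AcbababcB";
"cBCAB3c2Ac3BCaC5b4C2 bc4bC4bc4Ab5abacbC C3Ac6AC4Ac9ba bac4bC4A2C4Ac9 ab2C4Ac9c5AC2AB";
"c2bCAc9c5AbabcaCB abcB2c4aC6ac4aBC2bc c4b3c5B2AC2acaC4bcA c3Babab3CBAC3bc7AC2";
"ac4b3c5B2ACBcaC3AbcB bC5bcAbab2C4AB3c2Ac2B cbC4acBabcBcb4C5bA2B c4A3C4Ac7bc3AC3";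
"caC9C6a2CABAbC3 ABAbC3BA2c9c6AC cAC3BcBC3A2BaC9aBC c4AC4B3abac3AC2Ac4B bCBA2c3bC4Ac7A2BCb2";
"AcbC3a2C2bAB2ac4b3c5 B2AbC4bc4A2BCb2C3aCacb aC3ac3B2ab3aBcBCBc3AcbC B3ACAc2bC3B2aC2b4c3ACA";
"c8AC4A3c3BCac3AC ABAbC4A2C4Ac9AC2 aCAbABC3Ac3bC4Ac5AC2 AC4Ac9AbcBabacAc2B";
"c5BC3a2CABCb2CBACa2C4 C3ac4BC4BabacAc2BacAb2 ca3b2CAcb2c3AC2b2c3AC3B";
"cBababc2Ac2bC2Ac2AC2BCBabcB bAB2Ab2CB2aCAbCBaC7ac2 BCA2Cb3ac3Ac2B4AbC3acB caCac3ACAcbC5a3C7";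
"aCACbc2a2cbCAcAC4Ac7 CacBcaC2BCAcbC2Ac2AC2Ac2AC2 C2A2bcaCac2ab2C2Ac9A";
"cbC2Ac2AC2Ac2AC2bcACB2CacaC cBCA2c4BabaBCABC2ABCac4 C4A2CABAbCBaCAb2CBCAcbC3";
"Cac2bCbcabcA2BC2BC2Ba3bc2b aCA2c2abcB2cbaB2ABC4b2ac2 bCAcb3a2CBc2aC2a2bcB2cbaBC";
"cAb2aBabc3B2ABABCa2bc3BC2 CacaCB2CAcbCbAB2A2cbABCb2CB bCb4aB2ab2a2CBabcaCBc2B2A";
"b2AB2Ab2CBAbcACBAbcA2B4cB bCb4aB2ab2aB2cbaBCacbaB2A CacB3Cb2AB2Ab2AB2Ab2AB2Ab2";
"c3aCac4aC4ac3aC3BA3 a3b2CAc2aBc2A2c8AC3 aCAbCAcbC2Ac2AC2Ac2AC2bcACB";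
"CAcACAc2bcaCBc2BCacbaBCac2A aCA2cb2cB2cba2C2ac2BCacbaBC AcbABCb2AB2Ab2AB2Ab2CB3acA";
"b2AB2Ab2AB2Ab2AB2Ab2CB2aCac Bcb2ABAbCAb2AB2Ab2AB2Ab2AB2 AB2abcB2ab2aB2ab2aB2ab4AB";
"cACAcACbc3aC2ac2aC2ac2aC2a C9C9C2ABC6 c8BC6Bc4aC7 BC6Bc6ac6bC6 C9C9bc4babcB c5b3C7ac5BC5B";
"c4aC6b3CBC5Bc5B c5bC5bc4bC5AB3cb c3b2cB2cb2aBc9c2BC3 babc3bC5B3c7B3C3 c2bC3B7C5Bc5BCaC";
"c3BC3Bc5BC5B7AB caC3bCB8C5bc4b2C c3bC3bc4B2ab9c4 caC3bCB2c4BC4B9B CB8Cb3CB2C3bc2AcbC3";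
"bC4b2cBcbcAC3B9B2C b3CB9C3B3c3ACbc2B c3B2AC2B9B6C3bc c3B2ABCBc3b9b6c bc2BCBCB3Cb3CB9BABC";
"cBCBCB9B8CaC2B2 cb7cB3cb9bcAbcB cBCB9B8Cb3CBAB cAcb9b9b5cB cBCB9B9B5AB bab9b9b6cB c9c9caC6BA";
"C4bc6bC7Ac7A aC7Ac6b2c6bC4 c6bC9Cbc4AcabcB c6bC4bc6bABABC5 BC6Bc4BC5ac5b2aB b2ac5b3C6Bac4bC4";
"c3BC4ABCB3cb2c5BC4a c3Ac3BCaBcb4c2bC2bc4BC c3BC3ABAB2c5BC5B5 aC2b3C3bcbC2B2Cb2CBAbc5";
"aC4b3CB5C4B2cbc3BCa C3bc4B2ab9bc3aC3 cBCABAB8C5bc4b2CB ab2C4Bc2BCBc2bacb6cB3 cBCBc3aC4B9B3AbCB";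
"aC4B9B3AbC3B2cbcB C2BaCB9B7C2acBC2 ab7cB3cb7c2bC2bcA B2CBAbcbCAB5Cb3CB7C bcbCAc2Acb9b9b";
"aC2b3CB9B7Ab2CB b3CB5Ab2AB9Cb3CB b2CB9B8Ab2AB3C b9b2aB2ab9cB3 cAc6bCAc7AC9 c6bac4BC6ac7A";
"C9Cbc4AC7a2bcB b2c4AC9Cbc5A2c2B bc5AC5B2AbC4ABC6 bCBABC4ac6bac2BC6B c3b3C7bcAba2bc3bC4";
"bCBaC5BaBc3bC2Ac6B3 cbc4BCacBCABC3BAB3c4bC bc2BCBCAb2c6BCacBC2bAB2C bcbc3bCbCBCAcbc3Babc2BCB2A";
"B2ab2c4b2CBC3b2acAc4B3 cAC3B2cbcac2b8c2bac2B cbcB2C4acaCBCbAB9C2 bCBacbabcB2C4B2aCB7C2";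
"c3bcbCAcbab9cB2c2bAB bCAc2b7cB3cb2cB3cba2C bCB9B4C2acB2A2BCBc2 CB9B5Ab2A2BCBc2BC2";
"b3C3acB2CbAB9B3Ab2 cb9aB2ab9cAcbC B2cbaBCa2b9b6cB3 bab9aB2ab9bcbC bCB9B3Ab2AB8AB C9CAc7A2c6ba";
"c3BC6BaC6ac7A2 aC3aBC6B2C6ac3aC3 ABC6AbC5ac3BC5bcA ab2C8ABAbC4Bc3aC4 c4AC4BAbc5bC5ABAb2";
"c4bacbCAcAC5BCacbcBcbcB c5aB2C6B2abababc3BC2 cbABCB3cbc5bAcbC4aBc2A c4B2c2Aba2cb2CBAbC5b2cB";
"cACBCbCB4Ab2AC2acB2C4Bc2 cACAb2AB8C4bc3bCAc2 bc3AC3BCB8AbC2aC2AB2 c3B2ab9b2ac2aC3Bac2";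
"bCAc3B3C2bAB5AbC2b3aBc cb9ac2AbCBAbc3B2acB2 CBabcbcB2ab9bcAb2c3A B2AbCB9B2AbCB2caC3AB";
"bcB2CB7ACBabaBCAB6C cBCacBCAB9B7Ab2A b3CB6ACBabaBCAB9 B2AbCB6Ab2AB9BCAB b9b9cBabaB2A2B";
"caCBC5A2C7ac4aC4 aC6Ac5AC5Ba2c5B aBC6AcbABC6ac3aC4 C5ABac6B2a3c4bC4 A2c5bC4ABAbCBC4ac4B";
"bABC5Ac5b2a3Bc4bC3 cBCaC6Babc6acbababcB c2bC2bc3bcA2cbcBaCacB2ac3b aCB5AbC4BAbc5A2C2Bc2";
"caC2Abc3Bab2ab2ab2c5bcbc ABCBcabcabcb2cB2c2BC3B2CAcA aC4bcAcabcAC3B8Ab2C";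
"caC2BCBCaCAbcbcb2cbcBab5a bCAc2b9b3caCBc3A3C bAB5ACaCBc2BC2B5ABCacB aCB9Cb3CAb2A3cbC2bc";
"babcB3cacbABAbcab8cbC CBa3b2CAc2b9b6cA aC2b3CB4Ab2AB8A2bcB bcb2CBAB7Ab2AB5Ab2AC";
"b3CB9B2Ab2A3B3cbaB bABAbCB9B9A3B c3aC6ac6aC6BA3 c4BC4A3bcaCac6AC4 aCABCBC3A2CAc7BC4ac2";
"cAC2bc4aC2ac4Acac4Bab2 abcbC5aCABAbCBC5Ac4A cbC2Ac2bab3c4aC4acaC2AB bC2aCABacaC2AC3b2CAc4B2Cb";
"cb2C3Ac4aB2abacaC2Babc2bc c3b3C2aCaC4bc2bCABABAb2A Ab2c2bABAbcac4B3CAcbC2BaC";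
"bCBABaCAbC2B2Cb3c2Aba2c3bC bcAC2b3CB3Cb3CBAbCAc2A3C aB2ab8ac3bCACaCAbc3B";
"aCAbc2bC2AB2Cb3CAb2AB5Ca cb9b3a3CABac3B2CAc bacba2CBc2BCa2b9cBab2 b3C3acB2CbAB6Ab2ABAb2A";
"bAB2acBacAbAc2B2ab9b2 a2b2CAbacb3aB2ab8cB3 b8aB2ab8a2b2CAcA b5aB2ab6aB2abaB2acB3";
"c3BC5Ac2A4C4Ac6A aCA2cbC2AC3ac2aC4Bc5aC cbC2Ac2AC2Ac2AC2Ac2AC2BCacBc cACBC3Ac3A2c7A2BAbC3";
"aC2ac2aC2ac2aC2ac2BCacbcbCbC aCAbC6ac4BC3BA4BC3 C2ac2aC2ac2BCacbaBCacbc2ACbC";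
"aC2aC5BCacbabcBabcAc2ac3 cACBAbc4aC2ac2aB2AbC5AB cab2C3Ac4b4cAba3C2ac3";
"cbC2Ac2A2BCAcbCbCBAbCBCacBca bC2B2C4BababacBC3A3BaC3 b2a2CBabcaCBc2aC2ac2BCacb3C";
"cA2B2C2bA2BC4B2AbCAbC3acB cbABCAcbC2Ac2ACbAB2Ab2CB2Cac cA2BCb2c2aCac2aC2BabcBab4c";
"caCB2CAcbC2bcA2B2Ab2CBAbcACB aCAB3cbabcbAbcbcbCAcbcbaBCa Cb3cB2cba2C2ac2BCa2b2aB2ab2";
"cB3CAcbCbAB2A2cbC2bcA2B2Ab2 bCb2a2B2ab2a2CBabcBcBCacb3C cB3CAcbCbAB2Ab2CBAbcACBAb2a";
"b2a2CBabcB2ab2a2CBabcB2cb3C bAB5ACBabaBCACb3CBABCacB caC2acBab4aB2ab8a2CB";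
"b2aB2ab2aB2cbaBCa2b2aB2cb3C Ca2BA3bcA2B4Cb3CB8 BAbCB3ACBabaBCAB9A2B";
"Cb3cB2ab2aB2ab2aB2ab2aB2ab2 BAbACAB9B6A3BAbc BAbCB3Ab2AB9BAb2A3B c2aC2ac2aC2ac2aC2ac4ACbCAc";
"bC4Ac4AC5a3c3acaCac cACAcbc2aC2ac2aC2ac2aC2ac2BC b3CAbCAc2AC2Ac2AC2Ac2AC2bcA";
"cACAcbc2aC2ac2BCacbaBCacbaBC bcaCBabcaCBc2aC2ac2BCa2caCB2 cbC2Ac2A2BCAcbABCAcbABCBCacB";
"c2A2BCb2CB2aCAbCbcACBAbcAC2a b2AB4AbCAc2AC2Ac2ACbA2B2cB aCB3A2cbABCb2CBA2c2A2BCb2CB";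
"b3CA2cbABCAcbABCAcbABCb2AB2 B2ab2aB2ab2aB2acAb2cBcaB2AbC B2ab2a2CBabcB2ab4aB2cbaB2A";
"b4a2CBcBab2aB2ab2aB2ab2aB2 b3CAb2AB2Ab2AB2Ab2AB2Ab2AB2 c2ACAcACAcbC2Ac2AC2Ac2AC2Ac2";
"aC2AcbC2Ac2AC2bcACBAC2acaCac bCBA2c2A2BCb2AB2A2cbABCBCacB c9BC9AC9 c8bC9C9AB bc9bC7ABC9";
"C8Bc8Bab2c8 C7bc7ab2C9B2 B2AC7Bc7BC8B2 B2ab2c8b2C7Bc6 b2aB2c7bC6bc7B2 b2AB2C2bcbC7b2c5BC4";
"B2AB2C6bc5bC6B2CB2 AC8bc9AC9 bC9ac7aC9b c8AC8b2ac8B C7bAb2C9ac7B aB2AbC8bc7bC7 bac6BC7ac7b2cB2";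
"AB2cBac6bC6bc7b2 b2ab2aB2c7BC6Bc6 AB2C6Bc5BC6B2Ab2CB b2ac5bC5bc6B2cb2ab2 aBC9Ac9AC7";
"c7a2CBac8bC8 c7BC8ac8babA ABCB2C9a2c6bC6 c5bcBab2AC8bcAc6 c6BC7b2c7a2b2AB bc3b2CBABCAbC5bc5AC4";
"baBCAb2C5bc4bC6bAc2B c4BC5bAc7b2cB2ab2aB bcA2b2C5bc4bC5b2AB2CB aC9Ac8bC7A2 c7BC7ac8AbacA";
"bCBAC6ac5aC8BCac cAcAc7BC5Bc6baBCa ABC6Bc7BababAc7 AC6bc7Bab2aB2ac6 ABAb2a2bc7b2C6Bc5";
"bC4Ac6B2cbcAcbab2cbac3 B2acAbabc5bC4bc6B2AB a2B2ab2c5BC4Bc5B2cbaB aBC3a2C9ac5aC6";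
"CAc3Babac4aC6ac8 aCAB2AbC8ac6aC6 AcbABAbC6Ac7AC6b bAB2acbac6AC5Ac7B ABCBc4bCAc3bcAcbc3bcAC2aC";
"C5BA3B2cBabac6B2C5 cab2cb2aB2c5AC3bc3a2cBC2 b2CB2C4Ac4bC5bcA2BAb2a Cbc3aCBABC3B2CBABaC4BabcB";
"aCac6aC7A3cbC7 C3ac3BC8Abac4AC3A2 bc8AC3Ac6BCa2cbacA bacA2c4A2c6BC4ac4B2 CAbac6aC5Bc5Bab2a2c";
"c6a3B2AbABAbC6Bc5 bC2a2C6bc4AC4B2AbAB2a c3BC4Bc5B2cB2a3bcACAba Cb2CAbabACB2Ab2C4Ac4bC3A";
"bcbC4Bc2BC3b2ABCA3cbaBabc CAcbA2C6ac5aC7AcA C5bc4AC6AcAC2a4cbC aBABC4ac2BC5Ac3AC3Ac2A";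
"caC5BcaC4AbacbCA3cbC4 C2ac2aC2ac2BCacb2caCBc2BcaC2A Ac2aCBc2BCacb2caCBc2aC2ac2aC2";
"C2bcACB2CAcbABCAcbC2Ac2AC2Ac2 BacBab2ACbA2C5ac4BC4AB bcACB2CAcbC2Ac2AC2Ac2A2BCb2CB";
"C2Ac2A2BCb2CB2CAcbCbACbC2a2cB bcaCBabcBcBCacb2caCBc2a2CBAbC C2ac2aC2ac2aC2ac2aC2ac4ACbC";
"c4a3C2acBacAcAc7AC4 c2aC2ac2aC2ac2aC2ac2BCacbc2AC c2aC2ac2aC2ac2aC2ac2BCacb2caC";
"Cbca2C2ac2aC2ac2aC2ac2BCacb2c caC2BCAcbC2Ac2A2BCAcbC2bcAC2a cBCBCAcbABCAcbC2Ac2AC2Ac2A2BC";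
"cA2B2A2cbC2Ac2AC2bcACB2CAcbC2 aC2b2AB2A2cbC2Ac2AC2bcACB2CAc ba2C2Ab2CB2CAcbABCAcbCbAB2AbC";
"b2cB2ab2aB2cbaBCa2b2a2CBc2B2A B2Cb2AB2Ab2AB2Ab2CBAbcACBAbcA b2CBAbcA2B2Ab2AB2Ab2AB2AbCB2c";
"b2AB2Ab2AB2Ab2AB2Ab2CBAbcACB2 bCB2caB2ab2aB2ab2aB2ab2aB2ab2 b2AB2Ab2AB2Ab2AB2Ab2AB2Ab2CB2";
"caC2ac2aC2ac2aC2ac2aC2ac2bcAC c9c6bac9c4 C5bc5ac8BC9 b2ac9c4BC9C4 c3BC4bAC9Bc9B c9BC9Cb3CBC3aC";
"bC8Bc7aB3c4BC4 c9cAC9CBCb6C B6cBCac9cbC9 c9bC9b7AcbC c9aB9c9cB c9B2AC9b9 cB9B3c9AC7";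
"b9bCBABC8bc7 c4aC7BCb9b3CBC2 c7AC6b9b6C bC7b9b6AC6 c2bcB6cbcB9c3aC4 c4aC6b9b9C b9b8AC5Bc5B";
"C2bc5Ac2B9B9B b4CBCb9CBCb6C2aC2 b9b8CBCb3CBC3aC c2Ac2B9B3cbcB9B cB9B9B6c3AC c2Ac2B9B9B7";
"caB9B9B7c2B cB9B9B9aC aB9B9B9cB c4aC7BC8Ac8 c9Bac9c4aBc4 c9c3BC9C3AbcAb baBCacbc9c3bC9C";
"bac9c2BC9C3Ab3 c3AC2b6C8Ac9 cAC9CBc9acB6 C8AbcACBCb6C9 C3Ac5B9c5aC6 abcB9c8aC9 bcB9c8aCBAC7";
"B9c8aB2AbC8 B9B3c2Acac6bC6 b4CAc2ACb9C5bc5 Cb3CBC2BCb9AC3Ac5B cbcB9B4ac5BC5AB B9B7caC2ac5bC3";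
"B9B6ab2ac5BC5 cBC3BC2BCb9b4CBAbCBa B9B9cbacAc4BC2 bcB9B9cbc3aCBAC C3b9b3AB2Ab8C3";
"b9b7CAc2ACb6CB b9b9b6CAc2AC b9b9b7CAc2A AB2Ab9b9b5CBC b7AB2Ab9b8CB c8AC8BAC4Ac6 c7AC6bAC5Ac7B";
"C8ac9Ac2B3c2aC3 C9CBc9aBCacbacbC C9BCb3CAc2A2BC9 bC9AbcAb3CBCAC9 c9AC8b6CBA2c2";
"cbcB5aCBacAc9bC6 b5AC8AbCBaBc9B c7aB3cbaBCaB4c8B cAC7Ab9bCAC7b bC6ABCb9AcbCAC6";
"cAb4CBCb8C2aC5Ac4 cB3aCBabcB9c6AC4 C5b9b6CAc2A2C4 aC2b6CBCb9C2aC3Ac2 Cb9b6CBAbC5ac3a";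
"bC4aC3bcAb9b7AC c4Ac2B9B9aCBac caC3b4CBAbcAb9b5C bC2bc2aB9cbaBCaB8 b9b9AcbC2BCAcbAB";
"cB9cbcB9B2ab2a2C ba2C2Ab9b9b5C cB9B7ab2aB7aC bCAb9b9b6A2B c5aC6AbC8ac6a caBc9aC9CAbC4a";
"aCABa2bc9c3bC9C bc3Babac9bC9A2C c9BC9ACaCAbcAb3 c9AC8b6CAc2A2 c3bC3b4AcbCAcAC5bc5a";
"c9B4ab2a2b2ac9 C6A2bcaCac8bcB7 B8a2CABac8BC7 B9a2CABac8bC6 B9caC2ac6aB2AbC5 c3aC6BAbcAb9CBC2BA";
"c3bC4Ac2ACb9bCBAbCBa c3AC2b9CBACaC2b5C2a Ac2B5cbacAc2B2cbcB7c2A aC2acB5c2Ac3BCaB9B2";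
"cAC2Ac3acB9B8cba B2ACBC2BCb6AB2Ab7C2aC cbcB8a2CABac2bcB9 cacB9Bab2aB9c2aC BCb9b9b2CA2cba2C";
"b9b3AB2Ab8CAbcaC cAbacB7ab2aB9B5 bcB7ab2a2b2aB9B4 cAC4Ac5a2bc7aC7 c7a2c6AC4ABAbC6";
"C3aCABCb2CAC8ac7aC cAC9BCb3CAc2A3C7 ac9acbabcBabac9B c7a3C2acB6c8aC bC7ac5aB4aCBabc4AC";
"bC2a2B5ab2ac7aC8 C5Ac6a2C2acB9c2A C5bc5abcBab2aB4c2aCBAC bC5ac3aB7aCBc2babc3A";
"b2CBCb8C2aC3A2C2Bc2aCac c4abcB9B2aCBacAcac4 bC4aCABCb9CBC2BAbcA2C c3BC4b9CBA2BaCAb2Acb";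
"c4aB2AbC5b9bA2B2ab b4CAc2A2bcAb9b3C2aC2 ABaCAb5CBCb9AcbCAcbC bCAcAb7CBCb9AcbCA2";
"caB9B9a2CABac3B ABAbCBa3bcB6cbcB9B bC2b9AB2A2B2Ab8AC cAb9b9AB2A2B2AbC BAbCBa2B9B9ab2aB";
"Cac9cBacAcA2C9AC c2bC9CA3cba2Cac8 bCAc2acaC2ac2babc8AC5 BCAcbCAC8AcAba2c8B c9BabaBabcBc9a3";
"c7aB2AbC9BAbcA2BCa c8bC7A2BaCAb4ABCa ca3bcACAcAC2b6C5bc5 b6CA3C6bc7Baba2C";
"ABCacB5c2Ac4Ac3aC2acB4 cA2BAbC6b9CA3C5 aCBc3Ac3bcaCBaBCacBCaB7 aCABC3aC2b9b2CAc2A2BC2";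
"cbcB4acAba3C2ac2bcB6cbc C2acB2a2CABacB9B3c3AC C2Bc2B9B4acAba2caCBAC C2acB5cbcB6ab2aB2ac2A2B";
"C2acB9B9a3C2AcA AB2Ab6AcbABCb8CAbcaC Ac2Bab2aB9B7aCBacA aCBAb9AB2Ab8CAcba";
"B2Ab3AB2Ab9bCBABCAb2aB ba2B2AbCAb8AB2Ab9 aC4aC3A2C6Ac8BacA c7BC9Ac2A4bcaCac bCAcACAcba4c8BC8";
"c3aCacaCBA3C4BABC5bc4 bC2a2cBac2aBc6AC4AbC3bA BAb2a3BABac2Ac9bC6 C2Ac6Ac2B5cbcaCaCacbacA";
"bac5BC6Ab5CAc2A3BaC aCBAb6CBA3C5Bc5aCac bac5AC4Ab8CBA3c2aC c4abcBacAba2bcB6aCBac4";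
"caC4AbacA3cbC2BABCb8C c2BabaBacbCbA3C3bcAb6CBC bC3ABac2ac2Ac2Bab2aB9a cACBA2BaCAbC2aCABCb9b2C";
"bAB2aB9c2AcacBacB2ACbAC BAbCAcba3B3cbcBaCBabcB7 caC2A2BaCAb7AB2Ab8C ba2bcACAb6AB2Ab7CBABC";
"aCacbA2b9AB2Ab6AbcB baBCAb8AB2Ab6A2bcBab ba3B9B5ab2aB3acBab bC5A2C3aC3Ac2ACAC5AcAC";
"C2ac2BCacbc2aC2ac2aC2ac2aC2ac2 C2ac2BCacbc2aC2ac2aC2ac2BcaC2A cbc2BCacba2C2ac2aC2ac2aC2ac2BC";
"c2aC2ac2BCacba2C2a2bcB2cbcBc2A AC3Ac2AC2AbacA2b8CBAbC2 A2bcaCacB8aCBacAc3bacbC";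
"bcaCBc2BCacbaBCa2b2aB2cbaBCaB2 aCBabcB2ab2a2CBabcaCBabcB2cbcB abcaCBabcB2cbaBCa2b2aB6c2A";
"ba2C2acB2cbaBCaB9a2CBAb bcB2ab2aB2ab2aB2cbaBCacbaBCaB2 bcaCBabcB2ab2aB2ab2aB6abcA";
"aB2AbCb6AB2Ab2AB2Ab2CBAbcA aB2AbCb6AB2Ab2AB2Ab2CBAb2a b5AB2Ab2AB2Ab7ABAbCBa2 c9c9c9BCaC";
"c9c9c9abcB c9c9c9B2AB b2ab2C9C9C8 c7BCBc9c8B2AB c9c9c5B2AB3CB b2AB4c9c9c5B B3c9c9c3abcB4";
"b3cB3c9BCBc9abc B4aCBc9c9cB5 b4AB6c9c9cB b5aB4c9c8BCB2 b4AB6c9BCBc7B bC9C7b6AB7 Cb8C9C5Ab7";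
"Bc9c5B7ab8 B6cb9ab2C9C3 B8Cb8C9AbcBc c9BCaB9Cb9 b7CBACbcb2cb2cbC5b6 abcAC9C9C9 c9c9c8BabcA";
"c9c9c8Bab2a CABac6BCBc9c8B cbC9C4bcbC9ABAB acbac9c9BCB2CBc2B c7Bab2aBc9BCBc4BC b4C9C9Ac2ACb4";
"c9c2abcB3AB3CBc6BC b4C8ABCAcbC9b4 b4CB4acbac8BCBc7 cAb6C9C7Ab6 bac9c7B7Ab5 B7Cacbac9c4B6";
"b7CB8c3aC2ac8 C9C2ABCAb7CB8 B8Cb8C9AbcaC B9Ab8C9C2AB bcbABCAcbC6b8cB7 AcbC8b9AB9B AbC9C9C8AcA";
"bC9C7Ac2AC8AB aBABAbC9C9C7 c9c9cBCBc3BacAba C9C9bAB2AbC4ABC CacB3cb3A2C9C9C BAbCBaBc9c9c2B2AB";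
"BCb2cA2B2AbC5bcbC9C3 b2CB4aCABac6BCBc9c C4bAB2AbC9C3Ab3cB3c BCAcbC6bAB2AbC8b3cB2";
"Cb5cB4ac9c5Bab2a b4AbcAbab2C9C4b5C B6aC2ac9cBCaCB7 b4Ab3ab2C9C4b5AB b5ACb3CBAC9b6CAb";
"b7AB8acbac9cB B5ac4BCBc3BCB3AB7aC bCbcbC5Ac2Ab9aB7 b6cB6c7Bab2aB3AB2 abcA2c2AC9C9C5";
"acbac4aC2ac9c9B CBc9c4BacAba2c9 a2CABac9c3BCBc9B BAbC9C6bcbC5ABCA2 B3Ab2CAc2AC9C9AB";
"ABAbCBa2BCBc9BCBc8 a2b2Cb3ab2C9C9AB bC9C5ABCAcbCAb2AB4c bC2Ac2AC5b2ab4ab2C8b bac9aC2ac4BCB6Ab3";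
"b3C6bAB2Ab2cbC7ABCAb2 c9BCBcBCaBAB2c2B2AB4AB B3acba2bcB2CBabcBc9B4 A2b6CB7caCacBCBc7";
"B8Cb8C5Ac2ACACaC caB8Cb8CAC6Acba cACBac6B8aCBAb8 CABac6aB8ab9bC a2B9Cb9ABAbC6 aBac9c9c5aCa2C";
"C9C9C3AbacA3c2B A2bab2C9C9C4AcA AbAC9C9ABCAcACb2C bab2ABCAcbC9Ac2AC8 CABac9aC2ac8B2AB3";
"acbCb3ab2C9C7AbacA C9C2Ac2ACAc2Ab4Ac2B4 BCb3ab2C9C5ABABAbC2a bcB3AB2c9abcBababac5";
"c9Bab2a2CB3AB3CBc3abc B4a2b2Cb5C5Ac2AC6AB cBCAbcb2cAcb3ab3AB2AbC8 b6CBAC5A2BaCAbC5b5";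
"cB7Cb6A2bacA2cbC7 bC5bcb2cACBAb2ab4ab2C2bAB2 CBACbCBAbcb2cb2cACBAbCBAb3CB3 b7ABAb2a3B7c8B";
"B5a2cbABAb8ab2C5bCB b5AB8Cacbac3abcB4Ab c9c9c2a3BCAcACAc ABAbC4Ac2AC9C8A2 c9c9cacBabaBCA3C";
"Ac2AbAB2AbC9CAc2AC7 C9C7bcbCABAbCAcba3 c9BCa2b2aBababac9 BAb2cbC6Ac2AC9b2abA2";
"cac5Bab2aBc7abcaCB2CBac aB4aC2ac9cBCaCaCacB4 b2ABAbC2a3B4AB2c9c4 ac6BCBcBab2aBcBCBc3abcBaba";
"cBCBc2BCBcaC2ac2BCBc2B2AB2ababa Cb3ABAb4C2aB3a2B2ac9 B6Ab5ABCAcbC7Ac2A2B aCA2C2aca2c5B8Cb7";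
"bABAb4ABCb3ab2C8bA2b3 cbacB2AB3cbacBCacB5c2Ab4A C3A2b9CAc2aB9acA b6CAb3cB3caB7a2C2AcA";
"caB3AB4AB2abcB3AB3CB2CBacB CacaCBA3C9C6Ac2AC3 C9ABCAcbC9A2Ca2CA aC2ac9c8BCa3bcA2B";
"ac3abcBababac9c6acA cBabaBCA4c2AC3bcbC9C2 AB2A2cbC4ACaCAbCBAC9bc a2C2AcAC9C2Ab3ACBcB3aC";
"acbac9abcBababac5Bab2 c2aC2ac2BCacbaBCacbaBCB2CBcBc2A a2B5Ab4CAcAC4Ac2AC6b";
"bC6Ac2AC4ABCA2b3AB5ab Ac2B2cbaBCacbaBCacbaBCB2CBcBc2A bC9bAB2AbABCA2B2AbCb3aB";
"caB2ab4CAC6ACaCAb5aB3 babA2B2AbC6bAB2AbC2b2ab3CB CABacBCBc3B2AB3CB2acB2ab3A2B";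
"Ab3ab3CBAbcb3ab4ab2C4AcA b6cB7CB2Cacba2Ca2CBAbA b2aBc2Bab2aB3AB3cbacaB2ab4C";
"caB4caB5ababAb5CAb4CA a4C2ac9c7BCacaCac a4C2AcACAcAC6bcbC9 ca4CABac9c8acBab";
"A3C7Ac2AbcbC7ABAbCAc cA2BAbca3c8aC2ac4BCB2C bABCaB2CBc2aC2ac2aC2ac2aC2ac2BC";
"c9BCa2BA2Ba2CBaC2acBCB2C a2CABAbABCb3ab2C9C2Ac2A CbAB2AbC2ABCAcbC5Ab2CAc2aBaC";
"bC5ACaCAbAB2Ab3ab2CAc2AC3b cbaBCBc8BCacbaBab2a3b2aB C3bcb3ab4ab2C2ABCAcACBA2c2A";
"caC2A2CaCAbcAcbCAb6cB5aC cac2ACACb7A3c2aCacB7 b2ab2C6b4A4BCacBabaB4";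
"aCBA2CBAb2abAcbC2bcb3ab4ab2C a3B3Cb3ABAbCAcb5AC2acB4 baBCA2b8CAcAC2a3B8";
"B2AB4AB2abcB2acB4abcAb3A2B ab2ABCb2AB2Ab2AB2Ab2CBAb3AB4 c2aC2ac2aC2ac2aC2ac2aC2ac3Bc2A";
"cA2B2A2cbC2bcbABCAcAbab2C2bcACB ABCacB2AB3aCABacBab2aBc4acbC c2Ac2b4AB4Cb6a2b2CA2c2aC";
"cbaB3AbCB6Ab2AB4aCB2CAcbA ba2C2BabcB4AbAB5AB3ab2cb3 b2c2BCBcBabcB2cbaBCa2b2aB2ac2A2B";
"b3aB3cb5CBAbcACBAbcACBA2c2A C2ac2aC2ac2aC2ac2aC2B2AbC2BcBcBc2 ab2ABCb2AB2A2cbC2bCAc2bABCb2AB4";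
"AB3ab2cB3cBab2a2CBabcB2ab2aB4 b3AB3AbCB3ab2aB2ab2aB2ab2aBcBC ab2ABCb2AB2Ab2CBAb3AB3Ab3AB4";
"B2Ab2AB2Ab2AB2AbCb3AB3Ab3AB4 C2ac2aC2ac2aC2ac2aC2B2C2Ac2bCbC2Bc";
"c2AC2Ac2AC2Ac2AC2Ac2b2c2aC2BcBcbcB C2Ac2AC2Ac2AC2Ac2AC2Ac3bc2aC2Bc3";
"BaCBC6BAbcbC5acB2CAcAC2B2c2A BcaC2Ab2AB2Ab4c2BCBcaCacBab3CbCb";
"b2CBAbCbcbaBcaBcbcbABCAcbCbAB2Ab2CB bcbaBCBabcbaBCBcBab4cbABCb2CBAbcA";
"b2cbC2bcA2B2Ab2CBAb3AB3Ab3ABCBcB bababcBabcAbc2BCacbc4a2b2c4Ac3";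
"b2CB2Cb2CbCBCacBacBab2aBcaC2ac2a2CB c2aC2a2bcB2cba2C2BC3Ac3AC3bCbc2Bc";
"CbA2BCAcbCbCBAbcb2cB2cBab2cB3abcbAB bcbaBCBabcb3CAbCbcaBcaB3ab3aBcBCB";
"b2cbaBCBcBab3aB3ab3aB3abcB2acbCb bcB2ab2aB4CBAbcbCbAB3A2cb2AB2Cb3 B3ab3aBcBCBcBab3aB3ab6CBAbcA";
"B3acBab2ACb5aB3ab3aB3cBab3Cb b3AB3Ab3AB3AbCbcbABCB4ab2aB2cb Ab6aB5cB8Ab5AB3A2cA";
"B5acB2A3b3AB7ab3aB8 c4acA3BC4BCBAbcbc3A2cbC2Ac4B c2aC2ac2BCacba2CBc2aCBc2B2CbCAbCAbCB";
"B3A2cb2AB2Cb3AB5caB2AbCAbCb3aB cA2B3cBab2cB3ab3aB3ab6AB2Ab2";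
"CbAC2Ac2ACbCBAbCbc2BcbcB2c3aC3a2bc2 CbCbACbAB3abcB2cBabc2BCBabcb4ACBab";
"cBac2bC2bcAC3Ac3AC2bcA2BCAcbC2Ac2b2 caCBc2B3AbCAbCAcbcA2B2Cb3CB5ab2a";
"Bcb3CBAbcACBAb3AB3Ab3AB3AbCb3aB c2AC2bCAc2bC3Ac3AC3Ac3AC3bc2AC2B2";
"CbACb4CAbCbcbCbAB3Ab3CB2Ab2CBAbc2a bcB2abcbCbACbAB3Ab2CBAbCBCBabcB2cbaBc";
"b3AB3Ab3CB2Ab2cA2CbCBAbCb3aBcBcb2C b6cAb3cBab2cB3CABac2b2aB2ab4CA";
"BAbCb3aBcBcB3ab3aB3abcBcaB3Ab2CB2 B3ab3aB3ab3aBcBCBcBab6aBcB3Ab B3ab3aB3ab6aB3ab3aB3cBab3Cb";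
"C2Ac2AC2Ac3bc2aC2Bc3aC3ac3aC3ac3 cAC3acBc3aC3ac4Bc3ACbC2Ac2AC2Ac2";
"cBabcBcaC2ac2aBcaC3AcbC3bC3Ac3AC3 bcB2abcB2ab3ACbACbAC2acB3C2Ab3aBcBC";
"BCbCBacBab6aBcaC2BcBab2cB3ab3a2C baB2cbaB3AbCAbCb3ACb4CAb3CB2Ab3a";
"b4CBAb3AB3Ab3AB3A2cb2CBCb2cA2B3 bAB3Ab3AB6Ab3AB3Ab3AB3AbCbcb c2AC2Ac2bc3aC3ac3aC3ac3aC3acBc2bC";
"C2Bc3aC3acBcbcBcaC3ac3aC3ac3bc2AC2 ABC2Ac2bC3bc2AC2BAbc2AC2B2C2Ac2bCbC3ac";
"bcBcBcBac3AC2bcACAcAC2bCbcbCAcAC3acBcB cBab2cB3ab3aBcBCB3CB2cbcB2Ca2b3aBcaC2";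
"CbC3Ac3AC3Ac3AC3Ac3AC3BC2Ac2bC3Ac c2AC2BC3Ac3AC3Ac3AC3Ac3AC3Ac3AC3";
"Cac3ACbC3Ac3AC3AbCbc2bCbAC3ac2BCB2C2bcb cb2cbC2bc2aBcaC3Babc3BC2BcBabc2aC2Bc3aC2BA";
"Acb2ACb4Cb3aBcB4ab4a2CB3cb2cB3Cac2BC Cb6a2CB3ab3caCB3ab3cB4cBcBcBab3CAc";
"bcbcB2CBc2b2aBcBC3ac3aC3ac3aC3ac3aC3ac b2AB4cBab4aBcaBcB2cb2Acb2AB2Cb2CBAb2CBAb2cB";
"b2CBAbCAc3bCbAB2Cb3AB4Ab4ACb5CBAb4ABC BCa2cBcb2C2b3C2BCbCbCAbCbcb2caCB3cb2cBcBCBc2b2cb2cA3B"]%string.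

(** * Realizations for x = 7, 9 and 10 *)

(* The bound is 3 (x + 1): no multiplicity in the paths above is larger. *)
Lemma covered7 : covered 7 24 (pmap (profile_of 7) (walks 7 paths7)).
Proof. by vm_compute. Qed.

Lemma covered9 : covered 9 30 (pmap (profile_of 9) (walks 9 paths9)).
Proof. by vm_compute. Qed.

Lemma covered10 : covered 10 33 (pmap (profile_of 10) (walks 10 paths10)).
Proof. by vm_compute. Qed.

Lemma coprime_has_realization (x v : nat) (L : {mset nat}%mset) :
  x \in [:: 7; 9; 10] -> x + 1 <= v./2 -> size L = v - 1 ->
  finsupp L = [fset 1%N; x; (x + 1)%N]%fset ->
  coprime v x -> coprime v (x + 1) -> has_realization v L.
Proof.
rewrite !inE => /or3P [] /eqP ->.
- exact: (@covered_has_realization 7 24 _ v L isT isT covered7).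
- exact: (@covered_has_realization 9 30 _ v L isT isT covered9).
- exact: (@covered_has_realization 10 33 _ v L isT isT covered10).
Qed.

Theorem corollary6p3 :
  (forall (x v : nat) (L : {mset nat}%mset),
      x \in [:: 7; 9; 10] ->
      0 < v ->
      x + 1 <= v./2 ->
      size L = v - 1 ->
      finsupp L = [fset 1%N; x; (x + 1)%N]%fset ->
      (forall y : nat, y \in finsupp L -> coprime v y) ->
      has_realization v L)
  /\
  (forall (x v : nat) (L : {mset nat}%mset),
      x \in [:: 7; 9; 10] ->
      prime v ->
      x + 1 <= v./2 ->
      size L = v - 1 ->
      finsupp L = [fset 1%N; x; (x + 1)%N]%fset ->
      has_realization v L).
Proof.
split=> x v L hx v0 xv sL fL.
  move=> cop; apply: (coprime_has_realization hx xv sL fL); apply: cop;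
  by rewrite fL !in_fsetE eqxx ?orbT.
have lt y : 0 < y -> y <= x + 1 -> coprime v y.
  move=> y0 yx; rewrite prime_coprime // gtnNdvd //; apply: leq_ltn_trans yx _.
  by move: hx xv; rewrite !inE => /or3P [] /eqP ->; lia.
apply: (coprime_has_realization hx xv sL fL); apply: lt => //; move: hx;
by rewrite !inE => /or3P [] /eqP ->.
Qed.
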